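(* Let $A$ be an alphabet of size $n\ge 2$, let $k\ge 1$ and let $T\subseteq [1,k]$ be a nonempty subset of ranks. The $S_n$-module $\tilde H(T)$ given by the reduced homology of the poset of words in $A^*$ with lengths in $T$ is (as a virtual module) an integer combination of positive tensor powers $S_{(n-1,1)}^{\otimes i}$ ($i\ge 1$) of the reflection representation $S_{(n-1,1)}$, with the property that $\tilde H(T)+(-1)^{|T|}S_{(n-1,1)}$ has Frobenius characteristic equal to an integer combination of the homogeneous symmetric functions $\{h_{(n-r,1^r)} : r\ge 2\}$. Both integer combinations (that of $\tilde H(T)$ in terms of positive tensor powers, and that of the Frobenius characteristic of $\tilde H(T)+(-1)^{|T|}S_{(n-1,1)}$ in terms of $\{h_{(n-r,1^r)} : r\ge 2\}$) are nonnegative when $T$ is one of the following nonempty rank sets: (1) $T=[r,k]$, $k\ge r\ge 1$; (2) $T=[1,k]\setminus\{r\}$, $k\ge r\ge 1$; (3) $T=\{s_1,s_2\}$ with $1\le s_1<s_2\le k$.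
   Context: $A^*$ is the set of all finite words in the alphabet $A$, $|A|=n$, including the empty word, ordered by the subword order: $u\le v$ if $u$ is obtained from $v$ by deleting letters (not necessarily consecutive). The rank of a word is its length, and $[r,k]=\{r,r+1,\dots,k\}$. $S_n$ acts on $A$ by permuting letters, hence on words. For nonempty $T\subseteq[1,k]$, $\tilde H(T)$ is the unique nonvanishing reduced homology (with complex coefficients) of the order complex of the poset of words with length in $T$; it lies in degree $|T|-1$. $S_\lambda$ is the irreducible complex $S_n$-module indexed by the partition $\lambda$ of $n$. The Frobenius characteristic sends (virtual) $S_n$-modules to symmetric functions of degree $n$. $h_m$ is the complete homogeneous symmetric function, $h_0=1$, and $h_{(n-r,1^r)}=h_1^r h_{n-r}$, where $r\le n$. *)

(* Defs.v *)
(* Complex coefficients are taken in algC, the field of the character library. *)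
From HB Require Import structures.
From mathcomp Require Import all_boot all_order all_algebra all_fingroup.
From mathcomp Require Import all_solvable all_field all_character.
From mathcomp Require Import mpoly.

Set Implicit Arguments.
Unset Strict Implicit.
Unset Printing Implicit Defensive.

Import Order.TTheory GRing.Theory Num.Theory.
Local Open Scope ring_scope.

Section PermutationModule.

Variables (gT : finGroupType) (X : finType) (to : {action gT &-> X}).

(* Row-vector convention: the basis vector of x is sent to that of to x g. *)
Definition perm_action_mx (g : gT) : 'M[algC]_#|X| :=
  \matrix_(i, j) (to (enum_val i) g == enum_val j)%:R.

Lemma mul_perm_action_mx m (g : gT) (B : 'M[algC]_(#|X|, m)) i j :
  (perm_action_mx g *m B) i j = B (enum_rank (to (enum_val i) g)) j.
Proof.
rewrite mxE (bigD1 (enum_rank (to (enum_val i) g))) //= big1 ?addr0.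
  by rewrite mxE enum_rankK eqxx mul1r.
move=> x neq_x; rewrite mxE; case: eqP => [def_x|]; last by rewrite mul0r.
by rewrite def_x enum_valK eqxx in neq_x.
Qed.

Lemma perm_action_mx_repr : mx_repr [set: gT] perm_action_mx.
Proof.
split=> [|g h _ _]; apply/matrixP=> i j.
  by rewrite !mxE act1 (inj_eq enum_val_inj).
by rewrite mul_perm_action_mx !mxE enum_rankK actM.
Qed.

Definition perm_action_repr := MxRepresentation perm_action_mx_repr.

End PermutationModule.

Section OrderComplexHomology.

Variables (disp : Order.disp_t) (X : finPOrderType disp).

(* The (m-1)-simplices of the order complex; m = 0 gives the empty simplex. *)
Definition chain (m : nat) := {t : m.-tuple X | sorted <%O (val t)}.

(* The boundary map from m-simplices to (m-1)-simplices, as a matrix acting on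
   row vectors; for m = 0 it is the augmentation of the reduced complex. *)
Definition boundary (m : nat) : 'M[algC]_(#|{: chain m.+1}|, #|{: chain m}|) :=
  \matrix_(a, b) \sum_(i < m.+1)
    let s : seq X := val (val (enum_val a : chain m.+1)) in
    let t : seq X := val (val (enum_val b : chain m)) in
    (-1) ^+ i * (take i s ++ drop i.+1 s == t)%:R.

Variables (gT : finGroupType) (to : {action gT &-> X}).
Hypothesis to_mono : forall g : gT, {mono to^~ g : x y / (x <= y)%O}.

Lemma map_chain_subproof m (c : chain m) g :
  sorted <%O (val (map_tuple (to^~ g) (val c))).
Proof.
have ltJ : {mono to^~ g : x y / (x < y)%O}.
  by move=> x y; rewrite !lt_neqAle to_mono (inj_eq (act_inj to g)).
by rewrite /= sorted_map (eq_sorted (e' := <%O)) //; exact: valP c.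
Qed.

Definition chain_act_fun m (c : chain m) g : chain m :=
  Sub (map_tuple (to^~ g) (val c)) (map_chain_subproof c g).

Lemma chain_act1 m : @chain_act_fun m ^~ 1%g =1 id.
Proof.
by move=> c; do 2!apply: val_inj => /=; apply: map_id_in => x _; exact: act1.
Qed.

Lemma chain_actM m (c : chain m) : act_morph (@chain_act_fun m) c.
Proof.
move=> g h; do 2!apply: val_inj => /=; rewrite -map_comp.
by apply: eq_map => x /=; exact: actM.
Qed.

Definition chain_action m : {action gT &-> chain m} :=
  TotalAction (@chain_act1 m) (@chain_actM m).

Definition chain_repr m := perm_action_repr (chain_action m).

Lemma boundary_chain_repr m g :
  chain_repr m.+1 g *m boundary m = boundary m *m chain_repr m g.
Proof.
apply/matrixP=> a b; rewrite mul_perm_action_mx !mxE enum_rankK /=.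
under [RHS]eq_bigr do rewrite !mxE big_distrl /=.
rewrite exchange_big /=; apply: eq_bigr => i _.
set s := val (val (enum_val a)).
have ltiC : (i < size s)%N by rewrite /s size_tuple.
pose s' := take i s ++ drop i.+1 s.
have szs' : size s' == m.
  rewrite size_cat size_take size_drop ltiC size_tuple.
  by rewrite subSS subnKC // -ltnS.
have srt : sorted <%O (val (Tuple szs')).
  apply: (subseq_sorted lt_trans _ (valP (enum_val a))).
  rewrite -[X in subseq _ X](cat_take_drop i) /s' cat_subseq //.
  by rewrite -addn1 addnC -drop_drop drop_subseq.
pose c : chain m := exist _ (Tuple szs') srt.
rewrite (bigD1 (enum_rank c)) //= big1 ?addr0 => [|x neqx]; last first.
  case: eqP => [Ex|]; last by rewrite mulr0 mul0r.
  case/eqP: neqx; rewrite -[x]enum_valK; congr enum_rank.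
  by do 2!apply: val_inj.
rewrite !enum_rankK eqxx mulr1 -map_take -map_drop -map_cat.
by congr (_ * (_ : bool)%:R); rewrite -!val_eqE.
Qed.

Lemma cycles_module m : mxmodule (chain_repr m.+1) (kermx (boundary m)).
Proof.
apply/mxmoduleP=> g _; apply/sub_kermxP.
by rewrite -mulmxA boundary_chain_repr mulmxA mulmx_ker mul0mx.
Qed.

Lemma boundaries_module m : mxmodule (chain_repr m.+1) <<boundary m.+1>>%MS.
Proof.
apply/mxmoduleP=> g _; rewrite (eqmxMr _ (genmxE _)) genmxE.
by rewrite -boundary_chain_repr submxMl.
Qed.

(* The reduced homology in degree m >= 0, as the module of cycles modulo
   boundaries: section_repr U V is the image of V in the quotient by U. *)
Definition reduced_homology (m : nat) :=
  section_repr (boundaries_module m) (cycles_module m).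

End OrderComplexHomology.

Fact subword_display : Order.disp_t. Proof. exact: (Order.Disp tt tt). Qed.

Section Words.

Variables (A : finType) (k : nat) (T : {set 'I_k.+1}).

Definition rank_word :=
  {w : k.-bseq A | Ordinal (size_bseq w : size w < k.+1)%N \in T}.

HB.instance Definition _ := SubFinite.on rank_word.

Definition subword (u v : rank_word) := subseq (\val u) (\val v).

Fact subword_refl : reflexive subword.
Proof. by move=> u; exact: subseq_refl. Qed.

Fact subword_anti : antisymmetric subword.
Proof. by move=> u v /subseq_anti uv; do 2!apply: val_inj. Qed.

Fact subword_trans : transitive subword.
Proof. by move=> u v w; exact: subseq_trans. Qed.

HB.instance Definition _ := Order.Le_isPOrder.Build subword_display rank_word
  subword_refl subword_anti subword_trans.

Lemma map_word_subproof (w : rank_word) (s : {perm A}) :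
  Ordinal (size_bseq (map_bseq s (\val w)) : size (map_bseq s (\val w)) < k.+1)%N
    \in T.
Proof.
case: w => w /= Tw; congr (_ \in T): Tw.
by apply: val_inj; rewrite /= size_map.
Qed.

Definition word_act_fun (w : rank_word) (s : {perm A}) : rank_word :=
  Sub (map_bseq s (\val w)) (map_word_subproof w s).

Lemma word_act1 : word_act_fun ^~ 1%g =1 id.
Proof.
by move=> w; do 2!apply: val_inj => /=; apply: map_id_in => x _; exact: perm1.
Qed.

Lemma word_actM w : act_morph word_act_fun w.
Proof.
move=> s t; do 2!apply: val_inj => /=; rewrite -map_comp.
by apply: eq_map => x /=; exact: permM.
Qed.

Definition word_action : {action {perm A} &-> rank_word} :=
  TotalAction word_act1 word_actM.

Lemma word_action_mono (s : {perm A}) :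
  {mono word_action^~ s : u v / (u <= v)%O}.
Proof.
move=> u v; apply/idP/idP => [|uv]; last exact: map_subseq.
move=> /(map_subseq (s^-1)%g); rewrite /= -!map_comp.
by rewrite !(eq_map (permK s)) !map_id.
Qed.

(* H~(T), the homology in degree #|T| - 1. *)
Definition rank_homology :=
  reduced_homology word_action_mono #|T|.-1.

End Words.

Section Reflection.

Variable A : finType.

Local Notation SymA := [set: {perm A}]%G.

Definition letter_repr := perm_action_repr (perm_action A).

(* Inside the permutation module on A, i.e. on the tabloids of shape (n-1, 1),
   the vectors e_x - e_y are the polytabloids, so that their span is the Specht
   module S_(n-1,1); they are also the roots of type A_(n-1). *)
Definition root_vector (x y : A) : 'rV[algC]_#|A| :=
  delta_mx 0 (enum_rank x) - delta_mx 0 (enum_rank y).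

Definition root_space : 'M[algC]_#|A| :=
  (\sum_x \sum_y <<root_vector x y>>)%MS.

Lemma root_letter_repr x y (s : {perm A}) :
  root_vector x y *m letter_repr s = root_vector (s x) (s y).
Proof.
have deltaJ z : delta_mx 0 (enum_rank z) *m letter_repr s =
    delta_mx 0 (enum_rank (s z)) :> 'rV[algC]_#|A|.
  apply/rowP=> j; rewrite -rowE !mxE enum_rankK /= apermE.
  by rewrite -(inj_eq enum_rank_inj) enum_valK eq_sym.
by rewrite mulmxBl !deltaJ.
Qed.

Lemma root_space_module : mxmodule letter_repr root_space.
Proof.
apply/mxmoduleP=> s _; rewrite sumsmxMr; apply/sumsmx_subP=> x _.
rewrite sumsmxMr; apply/sumsmx_subP=> y _.
rewrite (eqmxMr _ (genmxE _)) root_letter_repr.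
by rewrite (sumsmx_sup (s x)) // (sumsmx_sup (s y)) // genmxE.
Qed.

Definition reflection_repr := submod_repr root_space_module.

Lemma trivial_mx_repr : mx_repr SymA (fun _ => 1%:M : 'M[algC]_1).
Proof. by split=> // s t _ _; rewrite mulmx1. Qed.

Fixpoint tensor_power (rG : representation algC SymA) (i : nat) :
    representation algC SymA :=
  if i is j.+1 then Representation (prod_repr rG (tensor_power rG j))
  else Representation (MxRepresentation trivial_mx_repr).

(* Virtual modules are represented by their characters. *)
Definition homology_char (k : nat) (T : {set 'I_k.+1}) : 'CF(SymA) :=
  cfRepr (rank_homology A T).

Definition reflection_char : 'CF(SymA) := cfRepr reflection_repr.

Definition reflection_power_char (i : nat) : 'CF(SymA) :=
  cfRepr (tensor_power (Representation reflection_repr) i).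

End Reflection.

(* A symmetric function is given by its restrictions to m variables, for
   all m. *)
Section SymmetricFunctions.

Variable m : nat.

Definition power_sum (d : nat) : {mpoly algC[m]} := \sum_(i < m) 'X_i ^+ d.

Definition complete_sym (d : nat) : {mpoly algC[m]} :=
  \sum_(u : 'X_{1..m < d.+1} | mdeg u == d) 'X_[u].

(* h_(n-r, 1^r) *)
Definition hook_complete_sym (n r : nat) : {mpoly algC[m]} :=
  complete_sym 1 ^+ r * complete_sym (n - r).

Definition frobenius_char (A : finType) (phi : 'CF([set: {perm A}])) :
    {mpoly algC[m]} :=
  #|{perm A}|%:R^-1 *:
    \sum_(s : {perm A}) phi s *: \prod_(c in porbits s) power_sum #|c|.

End SymmetricFunctions.

(* Main.v *)
(* By the Hopf trace formula, once the lower homology vanishes, the character of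
   H~(T) at g is a signed count of the chains of words over the f letters fixed
   by g. The number of words of length k above a given word of length r over
   these letters is a polynomial c(r, k) in x = f - 1, the value at g of the
   reflection character. Hence the character of H~(T) is P_T(x) for an integer
   polynomial P_T, and P_T(0) = 0, P_T(-1) = (-1)^|T|. The first equality leaves
   only positive tensor powers. Now x^i + (-1)^i x is a nonnegative combination
   of the falling factorials of f of order r >= 2, whose Frobenius
   characteristics are the h_1^r h_(n-r) (orbit counting for colourings with r
   marked letters), so that the second equality gives the other expansion, with
   nonnegative coefficients as soon as those of P_T are. The three families of
   rank sets are handled with sum_j c(i, j) C(k, j) (-x)^(k-j) = 1 for i <= k.

   For the vanishing, view all words as subwords of one long word W. A chain of
   words determines an order of deletion of the positions of W, the
   lexicographically smallest one passing through these words. A word met at a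
   non-descent of this order can be inserted in the chain, or removed from it,
   without changing the order, and every chain with fewer than |T| elements has
   a non-descent at some rank of T: this is an acyclic matching. *)

Require Import Defs.
From mathcomp Require Import all_boot all_order all_algebra all_fingroup.
From mathcomp Require Import all_solvable all_field all_character.
From mathcomp Require Import mpoly.
From mathcomp Require Import zify ring.

Set Implicit Arguments.
Unset Strict Implicit.
Unset Printing Implicit Defensive.

Import Order.TTheory GRing.Theory Num.Theory.
Local Open Scope ring_scope.

(** * Acyclic matchings on order complexes *)

Section SetComplex.

Variables (disp : Order.disp_t) (X : finPOrderType disp).
Implicit Types (H K S : {set X}) (z : {set X} -> algC).

Definition totally_ordered S := [forall x in S, forall y in S, (x >=< y)%O].

Lemma totally_orderedP S :
  reflect {in S &, forall x y, (x >=< y)%O} (totally_ordered S).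
Proof.
apply: (iffP forall_inP) => [tot x y Sx Sy|tot x Sx].
  exact: (forall_inP (tot x Sx)).
by apply/forall_inP=> y; exact: tot.
Qed.

Lemma totally_orderedS H K : H \subset K -> totally_ordered K -> totally_ordered H.
Proof.
move=> sHK /totally_orderedP totK; apply/totally_orderedP=> x y Hx Hy.
by apply: totK; apply: (subsetP sHK).
Qed.

(* The sign with which a face H occurs in the boundary of the simplex x |: H. *)
Definition face_sign x H : algC := (-1) ^+ #|[set y in H | (y < x)%O]|.

(** A chain is a function on vertex sets and the cofaces of H are the sets x |: H, so that no
    enumeration of faces is involved. *)
Definition set_boundary z H := \sum_(x | x \notin H) face_sign x H * z (x |: H).

(** As for [chain], m is a number of vertices: the empty simplex sits at m = 0 and the complex is
    augmented. *)
Definition set_chain m z :=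
  forall S, z S != 0 -> totally_ordered S /\ #|S| = m.

Lemma face_sign2 x H : face_sign x H * face_sign x H = 1.
Proof. by rewrite -expr2 sqrr_sign. Qed.

Lemma face_signU1 x y H : y \notin H ->
  face_sign x (y |: H) = (-1) ^+ (y < x)%O * face_sign x H.
Proof.
move=> Hy; rewrite /face_sign -exprD; congr (_ ^+ _).
have [yx|nyx] := boolP (y < x)%O.
  rewrite (_ : [set _ in _ | _] = y |: [set y in H | (y < x)%O]).
    by rewrite cardsU1 !inE (negPf Hy).
  apply/setP=> w; rewrite !inE andb_orl; congr (_ || _).
  by case: eqP => // ->; rewrite yx.
congr #|pred_of_set _|; apply/setP=> w; rewrite !inE.
by case: eqP => // ->; rewrite (negPf nyx) (negPf Hy).
Qed.

(** For comparable distinct x and y, exactly one of x < y and y < x holds and contributes the sign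
    -1. This makes the boundary square to zero. *)
Lemma face_sign_swap x y H : x \notin H -> y \notin H -> x != y ->
  (x >=< y)%O ->
  face_sign x (y |: H) * face_sign y H = - (face_sign y (x |: H) * face_sign x H).
Proof.
move=> Hx Hy nxy cxy; rewrite !face_signU1 // -!mulrA.
rewrite [face_sign y H * _]mulrC -mulNr; congr (_ * _).
by case: (comparable_ltgtP cxy) nxy => //; rewrite !(expr0, expr1) ?opprK.
Qed.

Lemma set_boundary_eq0 m z : set_chain m z ->
  forall H, set_boundary (set_boundary z) H = 0.
Proof.
move=> chz H; pose F x y : algC :=
  if [&& x \notin H, y \notin H & x != y] then
    face_sign x H * face_sign y (x |: H) * z (y |: (x |: H)) else 0.
have -> : set_boundary (set_boundary z) H = \sum_x \sum_y F x y.
  rewrite /set_boundary big_mkcond; apply: eq_bigr => x _; rewrite /F.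
  case: ifP => Hx /=; last by rewrite big1.
  rewrite big_distrr big_mkcond /=; apply: eq_bigr => y _.
  rewrite in_setU1 negb_or andbC [y == x]eq_sym.
  by case: ifP => // _; rewrite mulrA.
have FN x y : F y x = - F x y.
  rewrite /F andbCA [y == x]eq_sym; case: ifP => [/and3P[Hx Hy nxy]|_]; last first.
    by rewrite oppr0.
  rewrite setUCA; have [->|nz] := eqVneq (z (y |: (x |: H))) 0.
    by rewrite !mulr0 oppr0.
  rewrite -mulNr; congr (_ * _).
  rewrite [LHS]mulrC [X in _ = - X]mulrC; apply: face_sign_swap => //.
  by have /totally_orderedP := (chz _ nz).1; apply; rewrite !inE eqxx ?orbT.
(* F is antisymmetric, so the double sum is its own opposite, hence zero in characteristic 0. *)
have : \sum_x \sum_y F x y = - \sum_x \sum_y F x y.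
  rewrite {1}exchange_big -sumrN /=; apply: eq_bigr => y _.
  by rewrite -sumrN; apply: eq_bigr => x _.
by move/eqP; rewrite -addr_eq0 -mulr2n mulrn_eq0 /= => /eqP.
Qed.

Lemma set_boundary_chain m z : set_chain m.+1 z -> set_chain m (set_boundary z).
Proof.
move=> chz S nz; have [x Sx zx] : exists2 x, x \notin S & z (x |: S) != 0.
  apply/exists_inP; apply: contraNT nz; rewrite negb_exists_in.
  move=> /forall_inP z0; rewrite /set_boundary big1 // => x Sx.
  by have /eqP -> := negbNE (z0 x Sx); rewrite mulr0.
have [tot] := chz _ zx; rewrite cardsU1 Sx => -[<-]; split=> //.
exact: totally_orderedS (subsetU1 _ _) tot.
Qed.

(* Among the simplices with fewer than d vertices and a given value of the
   potential p, adding or removing the vertex v is an involution; as p decreases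
   along faces, a cycle can be filled starting from its highest level. *)
Section AcyclicMatching.

Variables (p : {set X} -> nat) (v : {set X} -> X) (d : nat).
Hypothesis p_face : forall S x, totally_ordered S -> (p (S :\ x) <= p S)%N.
Hypothesis v_eq : forall S S', totally_ordered S -> totally_ordered S' ->
  p S = p S' -> v S = v S'.
Hypothesis v_add : forall S, totally_ordered S -> (#|S| < d)%N ->
  totally_ordered (v S |: S) /\ p (v S |: S) = p S.
Hypothesis v_del : forall S, totally_ordered S -> (#|S| < d)%N -> v S \in S ->
  p (S :\ v S) = p S.

(** Clears the highest level p = N of the cycle z. The filling y lives on the simplices of level N
    that contain their matched vertex, and its boundary differs from z only on lower levels. *)
Lemma set_boundary_step m z N : (m < d)%N -> set_chain m z ->
    (forall H, (#|H|.+1 = m)%N -> set_boundary z H = 0) ->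
    (forall S, z S != 0 -> (p S < N.+1)%N) ->
  exists y, [/\ set_chain m.+1 y &
    forall S, z S - set_boundary y S != 0 -> (p S < N)%N].
Proof.
move=> ltmd chz dz0 zN; pose y K := if [&& p K == N, totally_ordered K,
  #|K| == m.+1 & v K \in K] then face_sign (v K) (K :\ v K) * z (K :\ v K) else 0.
have yP K : y K != 0 ->
    [/\ p K = N, totally_ordered K, #|K| = m.+1 & v K \in K].
  by rewrite /y; case: ifP => [/and4P[/eqP ? ? /eqP ? ?]|_] //; rewrite eqxx.
have chy : set_chain m.+1 y by move=> K /yP[].
have p_faceU S x : totally_ordered (x |: S) -> x \notin S -> (p S <= p (x |: S))%N.
  by move=> tot Sx; rewrite -{1}(setU1K Sx); exact: p_face.
exists y; split=> // S nzS.
have [totS cardS] : totally_ordered S /\ #|S| = m.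
  have [zS|/negP zS] := boolP (z S == 0); last by apply: chz; apply/negP.
  apply: (set_boundary_chain chy); apply: contra nzS => /eqP dy.
  by rewrite (eqP zS) dy subrr.
(* Above level N nothing happens: z vanishes there, and p decreases along faces, so the boundary of
   y vanishes too. *)
rewrite ltnNge leq_eqVlt; apply: contra nzS; case/predU1P=> [pS|ltNp]; last first.
  have -> : z S = 0 by apply/eqP; apply: contraTT ltNp => /zN; lia.
  rewrite sub0r oppr_eq0 /set_boundary big1 // => x Sx.
  have [->|/yP[pK totK _ _]] := eqVneq (y (x |: S)) 0; first by rewrite mulr0.
  by have := p_faceU _ _ totK Sx; lia.
have ltSd : (#|S| < d)%N by rewrite cardS.
rewrite subr_eq0; apply/eqP; symmetry.
(* If v S is not in S, the only coface of S where y can be nonzero is v S |: S, since all cofaces of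
   level N share the matched vertex v S. *)
have [Sv|Sv] := boolP (v S \in S); last first.
  have [totU pU] := v_add totS ltSd.
  rewrite /set_boundary (bigD1 (v S)) //= big1 ?addr0 => [|x /andP[Sx nxv]].
    rewrite /y pU -pS eqxx totU cardsU1 Sv cardS add1n eqxx /=.
    by rewrite (v_eq totU totS pU) setU11 setU1K // mulrA face_sign2 mul1r.
  have [->|/yP[pK totK _]] := eqVneq (y (x |: S)) 0; first by rewrite mulr0.
  rewrite (v_eq totK totS) ?pK ?pS // in_setU1 (negPf Sv) orbF eq_sym.
  by rewrite (negPf nxv).
(* If w = v S is in S, the cycle condition at H = S :\ w expresses z S through the values z (x |:
   H). These give the boundary of y at S, after x and w are exchanged in the signs. *)
set w := v S in Sv *; set H := S :\ w.
have Hw : w \notin H by rewrite !inE eqxx.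
have defS : S = w |: H by rewrite setD1K.
have totH : totally_ordered H by exact: totally_orderedS (subD1set _ _) totS.
have pH : p H = N by rewrite v_del.
have cardH : (#|H|.+1 = m)%N by rewrite -cardS defS cardsU1 Hw.
have vH : v H = w by apply: v_eq => //; rewrite pH.
have yE x : x \notin S -> y (x |: S) = face_sign w (x |: H) * z (x |: H).
  rewrite defS in_setU1 negb_or => /andP[nxw Hx].
  have delE : (x |: (w |: H)) :\ w = x |: H.
    rewrite setUCA setU1K // in_setU1 negb_or Hw andbT eq_sym.
    by rewrite nxw.
  have cardU : #|x |: (w |: H)| = m.+1.
    by rewrite cardsU1 in_setU1 negb_or nxw Hx cardsU1 Hw -cardH.
  have [zx|zx] := eqVneq (z (x |: H)) 0.
    rewrite zx mulr0; apply/eqP; apply: contraTT isT => nzy.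
    have [pK totK _ vK] := yP _ nzy; have vKw : v (x |: (w |: H)) = w.
      by apply: v_eq => //; rewrite pK.
    by move: nzy; rewrite /y vKw delE zx mulr0 if_same eqxx.
  have [totK cardK] := chz _ zx.
  have pK : p (x |: H) = N.
    by apply/eqP; rewrite eqn_leq -ltnS zN // -pH p_faceU.
  have vK : v (x |: H) = w by apply: v_eq => //; rewrite pK.
  have [] := v_add totK; first by rewrite cardK.
  rewrite vK setUCA => totU; rewrite pK => pU.
  have vU : v (x |: (w |: H)) = w by apply: v_eq => //; rewrite pU.
  by rewrite /y pU eqxx totU cardU eqxx vU delE !inE eqxx orbT.
have dzH := dz0 H cardH; move: dzH.
rewrite /set_boundary (bigD1 w) //= -defS => /eqP; rewrite addr_eq0 => /eqP dzH.
have -> : z S = - (face_sign w H * \sum_(x | (x \notin H) && (x != w))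
                  face_sign x H * z (x |: H)).
  by rewrite -mulrN -dzH mulrA face_sign2 mul1r.
rewrite big_distrr -sumrN; apply: eq_big => [x|x Sx].
  by rewrite defS in_setU1 negb_or andbC.
rewrite yE // [in face_sign x S]defS -mulNr !mulrA.
move: Sx; rewrite defS in_setU1 negb_or => /andP[nxw Hx].
have [->|zx] := eqVneq (z (x |: H)) 0; first by rewrite !mulr0.
have [totK cardK] := chz _ zx; congr (_ * _).
have pK : p (x |: H) = N.
  by apply/eqP; rewrite eqn_leq -ltnS zN // -pH p_faceU.
have vK : v (x |: H) = w by apply: v_eq => //; rewrite pK.
have [] := v_add totK; first by rewrite cardK.
rewrite vK => /totally_orderedP totU _.
have cxw : (x >=< w)%O by apply: totU; rewrite !inE eqxx ?orbT.
rewrite !face_signU1 //.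
by case: (comparable_ltgtP cxw) nxw => // *; rewrite ?(expr0, expr1); ring.
Qed.

(** Induction on a strict bound N for p on the support of z, each step lowering the bound by one. *)
Lemma set_complex_exact m z : (m < d)%N -> set_chain m z ->
    (forall H, (#|H|.+1 = m)%N -> set_boundary z H = 0) ->
  exists2 y, set_chain m.+1 y & set_boundary y =1 z.
Proof.
move=> ltmd; have [N] : exists N, forall S, z S != 0 -> (p S < N)%N.
  exists (\max_S p S).+1 => S _; exact: (leq_bigmax (F := p)).
elim: N z => [|N IHN] z zN chz dz0.
  exists (fun=> 0) => [S|S]; first by rewrite eqxx.
  rewrite /set_boundary big1 => [|x _]; last by rewrite mulr0.
  by apply/esym/eqP; apply: contraT => /zN.
have [y [chy yN]] := set_boundary_step ltmd chz dz0 zN.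
have [||y' chy' dy'] := IHN _ yN.
- move=> S nz; have [zS|zS] := eqVneq (z S) 0; last exact: chz.
  by apply: (set_boundary_chain chy); move: nz; rewrite zS sub0r oppr_eq0.
- move=> H cardH; have := set_boundary_eq0 chy H; have := dz0 H cardH.
  rewrite /set_boundary => z0 y0; under eq_bigr do rewrite mulrBr.
  by rewrite sumrB z0 y0 subrr.
exists (fun S => y S + y' S) => [S nz|S].
  have [yS|yS] := eqVneq (y S) 0; last exact: chy.
  by apply: chy'; move: nz; rewrite yS add0r.
have := dy' S; rewrite /set_boundary => dy.
under eq_bigr do rewrite mulrDr.
by rewrite big_split /= dy addrC subrK.
Qed.

End AcyclicMatching.
End SetComplex.

(** * Functions on sets and the matrices of the chain complex *)

Section ChainComplex.

Variables (disp : Order.disp_t) (X : finPOrderType disp).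

Definition chain_support m (c : chain X m) : {set X} := [set x in val (val c)].

Lemma sorted_lt_totally_ordered (s : seq X) :
  sorted <%O s -> totally_ordered [set x in s].
Proof.
rewrite lt_sorted_pairwise => /(sub_pairwise (@ltW _ X)) /= les.
apply/totally_orderedP=> x y; rewrite !inE => sx sy.
elim: s les sx sy => //= a s IHs /andP[/allP lea les].
rewrite !inE => /predU1P[->|sx] /predU1P[->|sy]; last exact: IHs.
- exact: comparablexx.
- by rewrite /Order.comparable lea.
- by rewrite /Order.comparable lea ?orbT.
Qed.

Lemma chain_support_totally_ordered m (c : chain X m) :
  totally_ordered (chain_support c).
Proof. exact/sorted_lt_totally_ordered/(valP c). Qed.

Lemma chain_uniq m (c : chain X m) : uniq (val (val c)).
Proof. exact: lt_sorted_uniq (valP c). Qed.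

Lemma card_chain_support m (c : chain X m) : #|chain_support c| = m.
Proof.
by rewrite cardsE (card_uniqP (chain_uniq c)) size_tuple.
Qed.

Lemma chain_support_inj m : injective (@chain_support m).
Proof.
move=> c c' /setP eqcc'; do 2!apply: val_inj.
apply: lt_sorted_eq (valP c) (valP c') _ => x.
by have := eqcc' x; rewrite !inE.
Qed.

Lemma chain_of_set m (S : {set X}) : totally_ordered S -> #|S| = m ->
  exists c : chain X m, chain_support c = S.
Proof.
move=> /totally_orderedP totS cardS.
have sz : size (sort <=%O (enum S)) == m by rewrite size_sort -cardE cardS.
have srt : sorted <%O (val (Tuple sz)).
  rewrite /= lt_sorted_uniq_le sort_uniq enum_uniq /=.
  apply: (sort_sorted_in (P := mem S)) => [x y Sx Sy|]; first exact: totS.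
  by apply/allP=> x; rewrite mem_enum.
exists (exist _ (Tuple sz) srt); apply/setP=> x.
by rewrite inE /= mem_sort mem_enum.
Qed.

(** The sum has at most one term, [chain_support] being injective; it is empty, with value 0, off
    the supports of chains. *)
Definition row_fun m (z : 'rV[algC]_#|{: chain X m}|) (S : {set X}) : algC :=
  \sum_(c | chain_support c == S) z 0 (enum_rank c).

Lemma row_fun_support m (z : 'rV[algC]_#|{: chain X m}|) c :
  row_fun z (chain_support c) = z 0 (enum_rank c).
Proof.
rewrite /row_fun (bigD1 c) //= big1 ?addr0 // => c' /andP[/eqP/chain_support_inj->].
by rewrite eqxx.
Qed.

Lemma row_fun_chain m (z : 'rV[algC]_#|{: chain X m}|) : set_chain m (row_fun z).
Proof.
move=> S; have [c /eqP <-|none] :=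
    pickP (fun c : chain X m => chain_support c == S).
  by rewrite card_chain_support chain_support_totally_ordered.
by rewrite /row_fun big_pred0 ?eqxx.
Qed.

(** Reconciles the sign of [boundary], given by the position in the tuple, with [face_sign], given
    by the number of smaller vertices. *)
Lemma index_chain m (c : chain X m) x : x \in chain_support c ->
  index x (val (val c)) = #|[set y in chain_support c :\ x | (y < x)%O]|.
Proof.
rewrite inE; set s := val (val c) => sx.
have us : uniq s := chain_uniq c.
have -> : #|[set y in chain_support c :\ x | (y < x)%O]| = count (< x)%O s.
  rewrite -size_filter -(card_uniqP (filter_uniq (< x)%O us)).
  apply: eq_card => y; rewrite !inE mem_filter /= -/s.
  by case: eqP => [->|_] /=; rewrite ?ltxx // andbC.
rewrite -[x in (< x)%O](nth_index x sx) count_lt_nth ?index_mem //.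
exact: valP c.
Qed.

Lemma boundary_entry m (a : chain X m.+1) (b : chain X m) :
  boundary X m (enum_rank a) (enum_rank b) =
  \sum_(x | x \notin chain_support b)
     face_sign x (chain_support b) * (chain_support a == x |: chain_support b)%:R.
Proof.
rewrite mxE !enum_rankK /=; set s := val (val a); set t := val (val b).
have us : uniq s := chain_uniq a.
rewrite [RHS](bigID (mem s)) /= [X in _ = _ + X]big1 ?addr0 => [|x]; last first.
  move=> /andP[_ /negP sx]; case: eqP => [eq_a|_]; last by rewrite mulr0.
  by case: sx; have /setP/(_ x) := eq_a; rewrite !inE eqxx.
(* Positions are replaced by vertices, which is possible because a chain has no repetition. *)
transitivity (\sum_(x <- s) (-1) ^+ index x s * (rem x s == t)%:R : algC).
  rewrite big_tuple; apply: eq_bigr => i _.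
  have -> : index (tnth (val a) i) s = i.
    by rewrite (tnth_nth (tnth (val a) i)) index_uniq // size_tuple.
  congr (_ * (_ == _)%:R); rewrite remE.
  by rewrite (tnth_nth (tnth (val a) i)) index_uniq // size_tuple.
rewrite big_uniq //= big_mkcond [RHS]big_mkcond; apply: eq_bigr => x _.
rewrite [in RHS]andbC; case: ifP => sx //=.
have -> : (rem x s == t) =
    (x \notin chain_support b) && (chain_support a == x |: chain_support b).
  apply/eqP/andP=> [def_t|[bx /eqP def_a]].
    have tE y : (y \in t) = (y != x) && (y \in s).
      by rewrite -def_t rem_filter // mem_filter.
    rewrite inE -/t tE eqxx; split=> //; apply/eqP/setP=> y.
    by rewrite !inE -/s -/t tE; case: eqP => [->|].
  apply: lt_sorted_eq (valP b) _.
    by rewrite rem_filter // lt_sorted_filter //; exact: valP a.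
  move=> y; rewrite rem_filter // mem_filter /=.
  have /setP/(_ y) := def_a; rewrite !inE -/s -/t => ->.
  by case: eqP => // ->; move: bx; rewrite inE => /negPf.
case: ifP => bx /=; last by rewrite mulr0.
case: eqP => [def_a|]; last by rewrite !mulr0.
rewrite !mulr1 index_chain ?inE // /face_sign def_a setU1K //.
Qed.

Lemma mul_boundary m (z : 'rV[algC]_#|{: chain X m.+1}|) (b : chain X m) :
  (z *m boundary X m) 0 (enum_rank b) =
  set_boundary (row_fun z) (chain_support b).
Proof.
rewrite mxE (reindex _ (onW_bij _ (enum_rank_bij (chain X m.+1)))) /=.
under eq_bigr do rewrite boundary_entry big_distrr.
rewrite exchange_big /=; apply: eq_bigr => x _; rewrite /row_fun big_distrr /=.
rewrite [RHS]big_mkcond; apply: eq_bigr => a _.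
by case: ifP => _; rewrite ?mulr1 ?mulr0 // mulrC.
Qed.

Lemma set_boundary_row_fun m (z : 'rV[algC]_#|{: chain X m.+1}|) (H : {set X}) :
  #|H|.+1 = m.+1 -> z *m boundary X m = 0 -> set_boundary (row_fun z) H = 0.
Proof.
case=> cardH z0; apply/eqP; apply: contraT => nz.
have [totH _] := set_boundary_chain (row_fun_chain (z := z)) nz.
have [c defH] := chain_of_set totH cardH.
by rewrite -defH -mul_boundary z0 mxE eqxx in nz.
Qed.

Lemma row_of_set_chain m (y : {set X} -> algC) : set_chain m y ->
  exists z : 'rV[algC]_#|{: chain X m}|, row_fun z =1 y.
Proof.
move=> chy; pose z : 'rV[algC]_#|{: chain X m}| :=
  \row_j y (chain_support (enum_val j)); exists z => S.
have [//|nS] := eqVneq (row_fun z S) (y S).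
have [c defS] : exists c : chain X m, chain_support c = S.
  have [yS|/chy[]] := eqVneq (y S) 0; last exact: chain_of_set.
  by rewrite yS in nS; have [] := row_fun_chain nS; exact: chain_of_set.
by rewrite -defS row_fun_support mxE enum_rankK eqxx in nS.
Qed.

(** Vanishing of the reduced homology in dimensions -1 to d - 2. At m = 0 the cycle condition is
    vacuous, and exactness says that the augmentation is onto. *)
Definition exact_below d := forall m z, (m < d)%N -> set_chain m z ->
    (forall H : {set X}, (#|H|.+1 = m)%N -> set_boundary z H = 0) ->
  exists2 y : {set X} -> algC, set_chain m.+1 y & set_boundary y =1 z.

Lemma exact_below_row d m (z : 'rV[algC]_#|{: chain X m}|) :
    exact_below d -> (m < d)%N ->
    (forall H : {set X}, (#|H|.+1 = m)%N -> set_boundary (row_fun z) H = 0) ->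
  (z <= boundary X m)%MS.
Proof.
move=> exX ltmd dz0; have [y chy dy] := exX _ _ ltmd (@row_fun_chain _ z) dz0.
have [w wE] := row_of_set_chain chy; apply/submxP; exists w.
apply/rowP=> j; rewrite -[j]enum_valK mul_boundary -row_fun_support -dy.
by apply: eq_bigr => x _; rewrite wE.
Qed.

Lemma kermx_boundary d m : exact_below d -> (m.+1 < d)%N ->
  (kermx (boundary X m) <= boundary X m.+1)%MS.
Proof.
move=> exX ltmd; apply/row_subP=> i; apply: exact_below_row exX ltmd _ => H cardH.
by apply: set_boundary_row_fun => //; apply/sub_kermxP; exact: row_sub.
Qed.

Lemma boundary0_full d : exact_below d -> (0 < d)%N -> row_full (boundary X 0).
Proof.
move=> exX d_gt0; rewrite -sub1mx; apply/row_subP=> i.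
exact: exact_below_row exX d_gt0 _.
Qed.

Lemma row_fun_boundary m (z : 'rV[algC]_#|{: chain X m.+1}|) :
  row_fun (z *m boundary X m) =1 set_boundary (row_fun z).
Proof.
have chz := set_boundary_chain (row_fun_chain (z := z)).
move=> S; have [c /eqP <-|none] := pickP (fun c : chain X m => chain_support c == S).
  by rewrite row_fun_support mul_boundary.
rewrite /row_fun big_pred0 //; apply/esym/eqP; apply: contraT => nz.
have [totS cardS] := chz _ nz; have [c defS] := chain_of_set totS cardS.
by have := none c; rewrite defS eqxx.
Qed.

Lemma mul_boundary_boundary m : boundary X m.+1 *m boundary X m = 0.
Proof.
apply/row_matrixP=> i; rewrite row_mul row0 rowE; apply/rowP=> j.
rewrite -[j]enum_valK mul_boundary mxE.
rewrite /set_boundary; under eq_bigr do rewrite row_fun_boundary.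
exact: (set_boundary_eq0 (row_fun_chain (z := delta_mx 0 i))).
Qed.

End ChainComplex.

(** * Deletion orders of a word *)

Section Embedding.

Variables (A : eqType) (L : nat -> A).
Implicit Types (E s t : seq nat) (u v g : seq A).

Local Notation "s <=l t" := ((s : seqlexi nat) <= (t : seqlexi nat))%O
  (at level 70).

Local Notation word E := (map L E).

Definition removed E E' := [seq e <- E | e \notin E'].

Arguments removed : simpl never.

(* The rightmost embedding of u, as a subsequence of the list of positions E. *)
Fixpoint embedding E u :=
  if E is e :: E0 then
    if subseq u (word E0) then embedding E0 u
    else e :: embedding E0 (behead u)
  else [::].

(* The maximal chain refining a descending sequence of words, as the sequence of
   deleted positions. *)
Fixpoint deletions E (gs : seq (seq A)) :=
  if gs is g :: gs' then
    removed E (embedding E g) ++ deletions (embedding E g) gs'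
  else [::].

(** The order of deletion s meets g when g is what remains after [size E - size g] deletions. *)
Definition passes E s g := word (removed E (take (size E - size g) s)) == g.

(** The two entries are the deletion that leaves n letters and the one after it. *)
Definition ascent E s n := (nth 0 s (size E - n).-1 < nth 0 s (size E - n))%N.

Lemma lexi_cat s1 s2 t1 t2 : size s1 = size s2 -> s1 <=l s2 ->
  (s1 = s2 -> t1 <=l t2) -> (s1 ++ t1) <=l (s2 ++ t2).
Proof.
elim: s1 s2 => [|x1 s1 IHs] [|x2 s2] //= => [_ _ ->//|[eqsz]].
rewrite !lexi_cons => /andP[le12 /implyP les] let12; rewrite le12 /=.
apply/implyP=> le21; apply: IHs => // [|eqs]; first exact: les.
by apply: let12; rewrite eqs; congr (_ :: _); apply/le_anti/andP.
Qed.

Lemma embedding_subseq E u : subseq (embedding E u) E.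
Proof.
elim: E u => //= e E IHE u; case: ifP => _; last by rewrite eqxx.
by apply: subseq_trans (IHE u) (subseq_cons E e).
Qed.

Lemma embeddingK E u : subseq u (word E) -> word (embedding E u) = u.
Proof.
elim: E u => [|e E IHE] u; first by rewrite subseq0 => /eqP->.
rewrite [embedding _ _]/=.
case: ifP => [uE _|]; first exact: IHE.
case: u => [|x u]; rewrite ?sub0seq // => uE /=.
by case: eqP => [-> /IHE ->|_]; rewrite // uE.
Qed.

Lemma removed_removed E E' : uniq E -> subseq E' E -> removed E (removed E E') = E'.
Proof.
move=> uE sE'; rewrite {2}(subseq_uniqP uE sE'); apply: eq_in_filter => e Ee.
by rewrite mem_filter Ee andbT negbK.
Qed.

Lemma size_removed E E' : uniq E -> subseq E' E ->
  size (removed E E') = (size E - size E')%N.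
Proof.
move=> uE sE'; rewrite {2}(subseq_uniqP uE sE') !size_filter.
by rewrite -(count_predC (mem E') E) addKn.
Qed.

Lemma perm_removed E E' : uniq E -> subseq E' E -> perm_eq (removed E E' ++ E') E.
Proof.
move=> uE sE'; rewrite perm_catC {1}(subseq_uniqP uE sE').
exact/permPl/(perm_filterC (mem E') E).
Qed.

Lemma removed_cat E s t : removed E (s ++ t) = removed (removed E s) t.
Proof.
rewrite /removed -filter_predI; apply: eq_filter => e /=.
by rewrite mem_cat negb_or andbC.
Qed.

Lemma removed_notin E s e : e \notin s -> removed (e :: E) s = e :: removed E s.
Proof. by rewrite /removed /= => ->. Qed.

Lemma removed_in E s e : e \in s -> removed (e :: E) s = removed E s.
Proof. by rewrite /removed /= => ->. Qed.

Lemma removed_cons_notin E s e : e \notin E -> removed E (e :: s) = removed E s.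
Proof.
move=> Ee; apply: eq_in_filter => x Ex; rewrite in_cons negb_or.
by case: eqP Ex Ee => // -> ->.
Qed.

Lemma sorted_ltnS e E : sorted ltn (e :: E) ->
  [/\ sorted ltn E, e \notin E, uniq E & {in E, forall x, (e < x)%N}].
Proof.
move=> /= pE; have srtE := path_sorted pE.
have gtE := allP (order_path_min ltn_trans pE).
split; [exact: srtE | | | exact: gtE]; last first.
  by move: srtE; rewrite ltn_sorted_uniq_leq => /andP[].
by apply/negP=> /gtE /=; rewrite ltnn.
Qed.

(** The rightmost embedding deletes greedily: as soon as u fits in the tail, the first position is
    deleted, and an s that starts elsewhere is larger. *)
Lemma embedding_min E u s : sorted ltn E -> subseq u (word E) ->
    uniq s -> {subset s <= E} -> size s = (size E - size u)%N ->
    word (removed E s) = u ->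
  removed E (embedding E u) <=l s.
Proof.
elim: E u s => [|e E IHE] u s srt uE us sE sz_s def_u.
  by case: s sE {us sz_s def_u} => // a s /(_ a (mem_head a s)).
have [srtE Ee uniqE gtE] := sorted_ltnS srt; rewrite /=.
have Eemb w : e \notin embedding E w.
  by apply: contra Ee => /(mem_subseq (embedding_subseq E w)).
case: ifP => [uE0|uE0].
  rewrite removed_notin //.
  have leuE : (size u <= size E)%N by rewrite -(size_map L) size_subseq.
  case: s us sE sz_s def_u => [|a s] us sE sz_s def_u; first by move: sz_s => /=; lia.
  have : a \in e :: E by apply: sE; exact: mem_head.
  rewrite in_cons lexi_cons => /predU1P[def_a|Ea]; last first.
    by have ltea := gtE a Ea; rewrite !leEnat ltnW //= leqNgt ltea.
  move: def_u; rewrite def_a removed_in ?mem_head // removed_cons_notin // => def_u.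
  move: us; rewrite def_a lexx /= => /andP[es us].
  apply: IHE => //.
    move=> x sx; have := sE x; rewrite !in_cons sx orbT => /(_ isT).
    by case: eqP => // def_x; rewrite -def_x sx in es.
  by move: sz_s => /=; lia.
(* If s deleted e, then u would fit in the tail. *)
have es : e \notin s.
  apply: contraFN uE0 => es; rewrite -def_u removed_in //.
  exact/map_subseq/filter_subseq.
move: def_u sz_s; rewrite removed_notin //= => <- /= sz_s.
rewrite removed_in ?mem_head // removed_cons_notin //; apply: IHE => //.
- exact/map_subseq/filter_subseq.
- move=> x sx; have := sE x sx; rewrite in_cons.
  by case: eqP => // def_x; rewrite -def_x sx in es.
Qed.

(* Each deleted letter differs from the nearest kept letter to its left, with b
   in the role of that letter at the left end. *)
Fixpoint tight (b : option A) E E' :=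
  if E is e :: E0 then
    if ohead E' == Some e then tight (Some (L e)) E0 (behead E')
    else (Some (L e) != b) && tight b E0 E'
  else E' == [::].

Lemma ohead_eq (T : eqType) (s : seq T) x :
  ohead s = Some x -> s = x :: behead s.
Proof. by case: s => //= y s [->]. Qed.

Lemma tight_subseq b E E' : tight b E E' -> subseq E' E.
Proof.
elim: E b E' => [|e E IHE] b E'; first by move=> /eqP->.
rewrite [tight _ _ _]/=; case: eqP => [/ohead_eq -> /IHE /=|_ /andP[_ /IHE sE']].
  by rewrite eqxx.
exact: subseq_trans sE' (subseq_cons E e).
Qed.

(** No letter deleted before the first kept one equals x; and by induction the kept word does not
    even fit strictly after its first kept position. *)
Lemma tight_max x E E' : tight (Some x) E E' -> ~~ subseq (x :: word E') (word E).
Proof.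
elim: E x E' => [|e E IHE] x E' //; rewrite [tight _ _ _]/=.
case: eqP => [/ohead_eq -> /IHE /= nsub|_ /andP[nex /IHE nsub]]; last first.
  rewrite /=; case: eqP => [def_x|_]; last exact: nsub.
  by rewrite def_x eqxx in nex.
case: eqP => _; first by [].
by apply: contra nsub; apply: subseq_trans; exact: subseq_cons.
Qed.

Lemma tight_embedding b E E' : tight b E E' -> embedding E (word E') = E'.
Proof.
elim: E b E' => [|e E IHE] b E'; first by move=> /eqP->.
rewrite [tight _ _ _]/=.
case: eqP => [/ohead_eq -> tE|_ /andP[_ tE]]; rewrite [embedding _ _]/=; last first.
  by rewrite (map_subseq _ (tight_subseq tE)) (IHE _ _ tE).
by rewrite (negPf (tight_max tE)) /= (IHE _ _ tE).
Qed.

(** With [tight_embedding], this describes rightmost embeddings by a local condition, which can be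
    followed through a composition. *)
Lemma embedding_tight b E u : uniq E -> subseq u (word E) ->
    (forall x, b = Some x -> ~~ subseq (x :: u) (word E)) ->
  tight b E (embedding E u).
Proof.
elim: E b u => [|e E IHE] b u //; rewrite [uniq _]/= => /andP[Ee uE] sub_u maxu.
rewrite [embedding _ _]/=; case: ifP => [sub_uE|nsub_uE]; last first.
  rewrite /= eqxx /=; case: u => [|y u] in sub_u maxu nsub_uE *.
    by rewrite sub0seq in nsub_uE.
  move: sub_u => /=; case: eqP => [def_y sub_u|]; last by rewrite nsub_uE.
  by apply: IHE => // x [<-]; rewrite -def_y nsub_uE.
rewrite [tight _ _ _]/=; case: eqP => [hE|_].
  have: e \in embedding E u by rewrite (ohead_eq hE) mem_head.
  by move/(mem_subseq (embedding_subseq E u)); rewrite (negPf Ee).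
apply/andP; split.
  apply/eqP=> def_b; have := maxu _ (esym def_b).
  by rewrite /= eqxx sub_uE.
apply: IHE => // x def_b; apply: contra (maxu x def_b) => sub_xu.
exact: subseq_trans sub_xu (subseq_cons _ _).
Qed.

Lemma tight_trans b E E1 E2 : sorted ltn E -> tight b E E1 -> tight b E1 E2 ->
    {in removed E E1 & removed E1 E2, forall x y, (x < y)%N} ->
  tight b E E2.
Proof.
elim: E b E1 E2 => [|e E IHE] b E1 E2 srt; first by move=> /eqP-> /eqP->.
have [srtE Ee uniqE gtE] := sorted_ltnS srt => t1 t2 lt12.
have sub1 := tight_subseq t1; have sub2 := tight_subseq t2.
move: t1; rewrite [tight _ _ _]/=; case: eqP => [/ohead_eq def_E1|_ /andP[neb t1]].
  set F1 := behead E1 in def_E1 *; rewrite def_E1 in t2 lt12 sub1 sub2 * => t1.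
  have subF1 := tight_subseq t1.
  have F1e : e \notin F1 by apply: contra Ee => /(mem_subseq subF1).
  move: t2; rewrite [tight b (e :: F1) _]/=; case: eqP => [hE2|hE2 /andP[neb t2]].
    have def_E2 := ohead_eq hE2; set F2 := behead E2 in def_E2 * => t2.
    rewrite /= hE2 eqxx -/F2; apply: IHE t1 t2 _ => // x y xE yE; apply: lt12.
      rewrite removed_in ?mem_head // removed_cons_notin //.
    rewrite def_E2 removed_in ?mem_head // removed_cons_notin //.
  (* The first step keeps e and the second deletes it. All first deletions precede e, so the first
     step deletes nothing after e. *)
  suff -> : E = F1 by rewrite /= neb t2; case: eqP hE2.
  rewrite -(removed_removed uniqE subF1).
  have -> : removed E F1 = [::]; last by rewrite /removed filter_predT.
  case def_r: (removed E F1) => [//|x r].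
  have xr : x \in removed E F1 by rewrite def_r mem_head.
  have e2 : e \in removed (e :: F1) E2.
    have F2e : e \notin E2 by apply: contra F1e => /(mem_subseq (tight_subseq t2)).
    by rewrite removed_notin // mem_head.
  have xr' : x \in removed (e :: E) (e :: F1).
    by rewrite removed_in ?mem_head // removed_cons_notin.
  move: (lt12 x e xr' e2); have : x \in E by move: xr; rewrite mem_filter => /andP[].
  by move/gtE/ltnW; rewrite leqNgt => /negP.
have subE1 := tight_subseq t1.
have E1e : e \notin E1 by apply: contra Ee => /(mem_subseq subE1).
have E2e : e \notin E2 by apply: contra E1e => /(mem_subseq sub2).
rewrite /=; case: eqP => [/ohead_eq hE2|_]; first by rewrite hE2 mem_head in E2e.
rewrite neb; apply: IHE t1 t2 _ => // x y xE; apply: lt12.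
by rewrite removed_notin // in_cons xE orbT.
Qed.

(** Rightmost embeddings do not compose in general: a in ab in aba is a counterexample. They do when
    all deletions of the first step precede those of the second, by [tight_trans]. *)
Lemma embedding_embedding E v g : sorted ltn E -> subseq v (word E) ->
    subseq g v ->
    {in removed E (embedding E v) &
        removed (embedding E v) (embedding (embedding E v) g),
        forall x y, (x < y)%N} ->
  embedding E g = embedding (embedding E v) g.
Proof.
move=> srtE vE gv lt12.
have uE : uniq E by move: srtE; rewrite ltn_sorted_uniq_leq => /andP[].
have sub1 := embedding_subseq E v; have uE1 := subseq_uniq sub1 uE.
have gE1 : subseq g (word (embedding E v)) by rewrite embeddingK.
have t1 : tight None E (embedding E v) by apply: embedding_tight.
have t2 : tight None (embedding E v) (embedding (embedding E v) g).
  exact: embedding_tight.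
have := tight_embedding (tight_trans srtE t1 t2 lt12).
by rewrite (embeddingK gE1).
Qed.

Definition supseq (u v : seq A) := subseq v u.

Lemma supseq_trans : transitive supseq.
Proof. by move=> v u w uv vw; exact: subseq_trans vw uv. Qed.

Lemma embedding_facts E u : sorted ltn E -> subseq u (word E) ->
  [/\ sorted ltn (embedding E u), uniq E, word (embedding E u) = u,
      size (embedding E u) = size u & (size u <= size E)%N].
Proof.
move=> srtE uE; split.
- exact: (subseq_sorted ltn_trans (embedding_subseq E u) srtE).
- by move: srtE; rewrite ltn_sorted_uniq_leq => /andP[].
- exact: embeddingK.
- by rewrite -(size_map L) embeddingK.
- by rewrite -(size_map L E) size_subseq.
Qed.

Lemma size_removed_embedding E u : sorted ltn E -> subseq u (word E) ->
  size (removed E (embedding E u)) = (size E - size u)%N.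
Proof.
move=> srtE uE; have [_ uniqE _ <- _] := embedding_facts srtE uE.
by rewrite size_removed ?embedding_subseq.
Qed.

Lemma removedK E u : sorted ltn E -> subseq u (word E) ->
  removed E (removed E (embedding E u)) = embedding E u.
Proof.
move=> srtE uE; have [_ uniqE _ _ _] := embedding_facts srtE uE.
exact: removed_removed uniqE (embedding_subseq E u).
Qed.

Lemma deletions_perm E gs : sorted ltn E -> path supseq (word E) gs ->
  last (word E) gs = [::] -> perm_eq (deletions E gs) E.
Proof.
elim: gs E => [|g gs IHgs] E srtE; first by case: E srtE.
rewrite [path _ _ _]/= => /andP[gE pgs] lgs.
have [srt1 uniqE wE1 _ _] := embedding_facts srtE gE.
rewrite -(permPr (perm_removed uniqE (embedding_subseq E g))) perm_cat2l.
by apply: IHgs; rewrite ?wE1.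
Qed.

Lemma passes_cat E s1 s2 g :
    size (removed E s1) = (size E - size s1)%N -> (size s1 <= size E - size g)%N ->
  passes E (s1 ++ s2) g = passes (removed E s1) s2 g.
Proof.
rewrite /passes => -> les1; rewrite take_cat ltnNge les1 /= removed_cat.
by rewrite subnAC.
Qed.

Lemma all_size_path u gs : path supseq u gs ->
  {in gs, forall g, (size g <= size u)%N}.
Proof.
by move/(order_path_min supseq_trans)/allP=> sub g /sub /size_subseq.
Qed.

Lemma deletions_passes E gs : sorted ltn E -> path supseq (word E) gs ->
  {in gs, forall g, passes E (deletions E gs) g}.
Proof.
elim: gs E => [|h gs IHgs] E srtE //; rewrite [path _ _ _]/= => /andP[hE pgs] g.
have [srt1 uniqE wE1 szE1 leh] := embedding_facts srtE hE.
have szD := size_removed_embedding srtE hE; have rK := removedK srtE hE.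
rewrite in_cons => /predU1P[->|g_gs].
  by rewrite /passes take_size_cat // rK wE1.
have leg := all_size_path pgs g_gs.
rewrite [deletions _ _]/= passes_cat ?rK ?szE1 ?szD; try lia.
by apply: IHgs; rewrite ?wE1.
Qed.

(** Minimality holds block by block, by [embedding_min]; the tails are compared only when the first
    blocks agree. Consequently more words in a chain can only raise its order of deletion. *)
Lemma deletions_min E gs s : sorted ltn E -> path supseq (word E) gs ->
    perm_eq s E -> {in gs, forall g, passes E s g} ->
  deletions E gs <=l s.
Proof.
elim: gs E s => [|h gs IHgs] E s srtE; first by move=> *; exact: lexi0s.
rewrite [path _ _ _]/= => /andP[hE pgs] eq_s pass_s.
have [srt1 uniqE wE1 szE1 leh] := embedding_facts srtE hE.
have szD := size_removed_embedding srtE hE; have rK := removedK srtE hE.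
have szs := perm_size eq_s.
rewrite -[s](cat_take_drop (size E - size h)) [deletions _ _]/=.
have sz1 : size (take (size E - size h) s) = (size E - size h)%N.
  by rewrite size_takel // szs leq_subr.
have us : uniq s by rewrite (perm_uniq eq_s).
apply: lexi_cat; first by rewrite szD sz1.
  apply: embedding_min => //; first exact: take_uniq.
    by move=> x /mem_take; rewrite (perm_mem eq_s).
  by apply/eqP/pass_s; exact: mem_head.
move=> eqD; apply: IHgs => //; rewrite ?wE1 //.
  rewrite -(perm_cat2l (removed E (embedding E h))).
  rewrite (permPr (perm_removed uniqE (embedding_subseq E h))).
  by rewrite eqD cat_take_drop.
move=> g g_gs; have leg := all_size_path pgs g_gs.
have := pass_s g; rewrite in_cons g_gs orbT => /(_ isT).
rewrite -[s in passes E s](cat_take_drop (size E - size h)) -eqD.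
by rewrite passes_cat ?rK ?szE1 ?szD //; lia.
Qed.

(** These are two stages of one deletion process, so that the words met by a single order form a
    chain. *)
Lemma passes_subseq E s g g' : passes E s g -> passes E s g' ->
  (size g <= size g')%N -> subseq g g'.
Proof.
rewrite /passes => /eqP def_g /eqP def_g' le_gg'; rewrite -[g]def_g -[g']def_g'.
have -> : (size E - size g = size E - size g' +
    ((size E - size g) - (size E - size g')))%N.
  lia.
by rewrite takeD removed_cat map_subseq // filter_subseq.
Qed.

Lemma ascent_cat E E1 s1 s2 n : size s1 = (size E - size E1)%N ->
    (size E1 <= size E)%N -> (n < size E1)%N ->
  ascent E (s1 ++ s2) n = ascent E1 s2 n.
Proof.
move=> sz1 le1 ltn1; rewrite /ascent !nth_cat sz1.
by rewrite !ifF; [congr (nth _ _ _ < nth _ _ _)%N | |]; lia.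
Qed.

(** Each block is increasing, so a descent can occur only between two blocks, at the length of a
    word of the sequence. *)
Lemma deletions_ascent E gs n : sorted ltn E -> path supseq (word E) gs ->
    last (word E) gs = [::] -> n \notin map size gs -> (0 < n < size E)%N ->
  ascent E (deletions E gs) n.
Proof.
elim: gs E => [|h gs IHgs] E srtE; first by case: E srtE => //=; lia.
rewrite [path _ _ _]/= => /andP[hE pgs] lgs; rewrite [map size _]/= in_cons negb_or.
move=> /andP[nh ngs] lt_n.
have [srt1 uniqE wE1 szE1 leh] := embedding_facts srtE hE.
have szD := size_removed_embedding srtE hE.
have [ltnh|lehn] := ltnP n (size h).
  rewrite [deletions _ _]/= (ascent_cat (E1 := embedding E h)) ?szE1 //.
  by apply: IHgs => //; rewrite ?wE1 ?szE1 //; lia.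
have srtD : sorted ltn (removed E (embedding E h)).
  exact: (sorted_filter ltn_trans _ srtE).
rewrite /ascent /= !nth_cat szD !ifT; [|lia..].
by apply: (sorted_ltn_nth ltn_trans) => //; rewrite ?inE ?szD; lia.
Qed.

(** An ascent at v joins the increasing blocks before and after v into one increasing list, which by
    [embedding_embedding] is the block of the direct step to g. *)
Lemma deletions_del E v g gs : sorted ltn E -> path supseq (word E) (v :: g :: gs) ->
    (size g < size v < size E)%N ->
    ascent E (deletions E (v :: g :: gs)) (size v) ->
  deletions E (v :: g :: gs) = deletions E (g :: gs).
Proof.
rewrite [path _ _ _]/= => srtE /and3P[vE gv pgs] szs asc.
have [srt1 uniqE wE1 szE1 lev] := embedding_facts srtE vE.
have gE1 : subseq g (word (embedding E v)) by rewrite wE1.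
have [srt2 uniqE1 wE2 szE2 _] := embedding_facts srt1 gE1.
have szD := size_removed_embedding srtE vE.
have szD1 := size_removed_embedding srt1 gE1; rewrite szE1 in szD1.
have srtD : sorted ltn (removed E (embedding E v)).
  exact: (sorted_filter ltn_trans _ srtE).
have srtD1 : sorted ltn
    (removed (embedding E v) (embedding (embedding E v) g)).
  exact: (sorted_filter ltn_trans _ srt1).
set E1 := embedding E v in szD szD1 srtD srtD1 gE1 srt1 srt2 wE1 szE1 uniqE1 wE2 szE2 *.
set E2 := embedding E1 g in szD1 srtD1 srt2 wE2 szE2 *.
(* The ascent compares the last entry of the first block with the first entry of the second; both
   are sorted, so all entries compare. *)
have lt12 : {in removed E E1 & removed E1 E2, forall x y, (x < y)%N}.
  have szD_gt0 : (0 < size E - size v)%N by rewrite subn_gt0; case/andP: szs.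
  have szD1_gt0 : (0 < size v - size g)%N by rewrite subn_gt0; case/andP: szs.
  have leqD s : sorted ltn s -> sorted leq s.
    by rewrite ltn_sorted_uniq_leq => /andP[].
  move=> x y /(nthP 0%N)[i lti <-] /(nthP 0%N)[j ltj <-].
  move: asc; rewrite /ascent [deletions _ _]/= -/E1 -/E2 !nth_cat szD ltnn subnn.
  rewrite prednK // leqnn szD1 szD1_gt0 => lt_asc.
  apply: (@leq_ltn_trans (nth 0 (removed E E1) (size E - size v).-1)).
    apply: (sorted_leq_nth leq_trans leqnn 0 (leqD _ srtD)); rewrite ?inE //.
      by rewrite szD prednK.
    by rewrite -ltnS prednK // -szD.
  apply: (leq_trans lt_asc).
  by apply: (sorted_leq_nth leq_trans leqnn 0 (leqD _ srtD1)); rewrite ?inE // szD1.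
have def_E2 : embedding E g = E2 by exact: embedding_embedding.
rewrite [LHS]/= [RHS]/= -/E1 -/E2 def_E2 catA; congr (_ ++ _).
have srt12 : sorted ltn (removed E E1 ++ removed E1 E2).
  rewrite (sorted_pairwise ltn_trans) pairwise_cat -!(sorted_pairwise ltn_trans).
  rewrite srtD srtD1 !andbT; apply/allrelP => x y; exact: lt12.
have srt3 : sorted ltn (removed E E2) by exact: (sorted_filter ltn_trans _ srtE).
apply: (irr_sorted_eq ltn_trans ltnn srt12 srt3) => x.
have sub1 : subseq E1 E := embedding_subseq E v.
have sub2 : subseq E2 E1 := embedding_subseq E1 g.
rewrite mem_cat !mem_filter; have [xE2|] := boolP (x \in E2).
  by rewrite (mem_subseq sub2 xE2).
case: (boolP (x \in E1)) => [xE1|]; last by rewrite orbF.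
by rewrite (mem_subseq sub1 xE1).
Qed.

Lemma deletions_del_cat E l v g gs : sorted ltn E ->
    path supseq (word E) (l ++ v :: g :: gs) ->
    (size g < size v < size (last (word E) l))%N ->
    ascent E (deletions E (l ++ v :: g :: gs)) (size v) ->
  deletions E (l ++ v :: g :: gs) = deletions E (l ++ g :: gs).
Proof.
elim: l E => [|h l IHl] E srtE.
  by rewrite [last _ _]/= size_map; exact: deletions_del.
rewrite cat_cons [path _ _ _]/= [last _ _]/= => /andP[hE pl] szs.
have [srt1 uniqE wE1 szE1 leh] := embedding_facts srtE hE.
have szD := size_removed_embedding srtE hE.
have ltv : (size v < size h)%N.
  have [_ lel] := andP szs; apply: leq_trans lel _.
  move: pl; rewrite cat_path => /andP[pl _].
  have := mem_last h l; rewrite in_cons => /predU1P[-> //|].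
  exact: all_size_path.
rewrite [deletions _ _]/= (ascent_cat (E1 := embedding E h)) ?szE1 // => asc.
by rewrite cat_cons [RHS]/= IHl ?wE1.
Qed.

End Embedding.
(** * Vanishing of the lower homology of subword order *)

Section WordPoset.

Variables (A : finType) (k : nat) (T : {set 'I_k.+1}) (a0 : A).
Hypothesis T_pos : ord0 \notin T.

Local Notation X := (rank_word A T).
Implicit Types (x y : X) (S : {set X}).

Definition word_of (x : X) : seq A := \val (\val x).

Definition rank_of (x : X) : 'I_k.+1 := 
  Ordinal (size_bseq (val x) : size (val x) < k.+1)%N.

Lemma rank_of_in x : rank_of x \in T.
Proof. exact: valP x. Qed.

Lemma word_of_inj : injective word_of.
Proof. by move=> x y eq_xy; do 2!apply: val_inj. Qed.

Lemma rank_word_of_seq (s : seq A) (t : 'I_k.+1) : t \in T -> size s = t ->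
  exists x : X, word_of x = s.
Proof.
move=> Tt sz_s; have szk : (size s <= k)%N by rewrite sz_s -ltnS.
pose b : k.-bseq A := Bseq szk.
have Tb : Ordinal (size_bseq b : size b < k.+1)%N \in T.
  by rewrite (_ : Ordinal _ = t) //; apply: val_inj.
by exists (exist _ b Tb).
Qed.

Lemma size_word_of_gt0 x : (0 < size (word_of x))%N.
Proof.
rewrite lt0n; apply: contraNneq T_pos => x0.
by have := rank_of_in x; rewrite (_ : rank_of x = ord0) //; apply: val_inj.
Qed.

(* It plays the role of an added maximum of the poset of words. *)
Definition universal_word : seq A := flatten (nseq k.+1 (enum A)).

Local Notation W := universal_word.
Local Notation L := (nth a0 W).
Local Notation E := (iota 0 (size W)).

Lemma word_iota : map L E = W.
Proof. by rewrite map_nth_iota0 ?take_size. Qed.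

Lemma size_universal_word : (k < size W)%N.
Proof.
have A_gt0 : (0 < size (enum A))%N by rewrite -cardE; apply/card_gt0P; exists a0.
by rewrite size_flatten /shape map_nseq sumn_nseq (leq_pmull k.+1 A_gt0).
Qed.

(** One letter is taken from each copy of the alphabet. *)
Lemma subseq_universal (s : seq A) : (size s <= k)%N -> subseq s W.
Proof.
rewrite /universal_word => /leqW; move: k.+1 => K.
elim: s K => [|x s IHs] K; first by rewrite sub0seq.
case: K => [|K] //.
rewrite [size _]/= [nseq _ _]/= [flatten _]/=.
rewrite ltnS => /IHs sub_s; rewrite -cat1s cat_subseq // sub1seq.
by rewrite mem_enum.
Qed.

Local Opaque universal_word.

Lemma sorted_iota : sorted ltn E.
Proof. exact: iota_ltn_sorted. Qed.

Definition words_of (S : {set X}) : seq (seq A) :=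
  sort (fun u v => size v <= size u)%N (map word_of (enum S)).

Lemma mem_words_of S x : (word_of x \in words_of S) = (x \in S).
Proof. by rewrite mem_sort mem_map ?mem_enum //; exact: word_of_inj. Qed.

Lemma words_ofP S g : reflect (exists2 x, x \in S & g = word_of x) (g \in words_of S).
Proof.
rewrite mem_sort; apply: (iffP mapP) => -[x Sx ->]; exists x => //.
  by rewrite -mem_enum.
by rewrite mem_enum.
Qed.

Lemma words_of_uniq S : uniq (words_of S).
Proof. by rewrite sort_uniq (map_inj_uniq word_of_inj) enum_uniq. Qed.

Lemma le_rank_wordE (x y : X) : (x <= y)%O = subseq (word_of x) (word_of y).
Proof. by []. Qed.

Lemma words_of_sorted S : totally_ordered S -> sorted (@supseq A) (words_of S).
Proof.
move=> /totally_orderedP totS.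
have srt : sorted (fun u v : seq A => size v <= size u)%N (words_of S).
  by apply: sort_sorted => u v; exact: leq_total.
apply: (sub_in_sorted (P := mem (words_of S))) srt; last exact/allP.
move=> _ _ /words_ofP[x Sx ->] /words_ofP[y Sy ->] le_yx.
have := totS x y Sx Sy; rewrite /Order.comparable !le_rank_wordE /supseq.
case/orP=> // sub_xy; have := size_subseq_leqif sub_xy.
by move=> /leqifP; case: eqP => [->//|_]; rewrite ltnNge le_yx.
Qed.

(** The empty word is an added minimum, so that the deletions exhaust the positions of [W]. *)
Definition descent (S : {set X}) := rcons (words_of S) [::].

Definition chain_deletions (S : {set X}) : seqlexi nat := deletions L E (descent S).

Local Notation pi := chain_deletions.

Lemma size_word_of x : (size (word_of x) <= k)%N.
Proof. exact: size_bseq. Qed.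

Lemma descent_path S : totally_ordered S -> path (@supseq A) (map L E) (descent S).
Proof.
move=> /words_of_sorted srt; rewrite word_iota /descent rcons_path.
rewrite /supseq sub0seq andbT; case def_s: (words_of S) srt => [//|g s] /= ->.
have : g \in words_of S by rewrite def_s mem_head.
by case/words_ofP=> x _ ->; rewrite andbT subseq_universal // size_word_of.
Qed.

Lemma descent_last S : last (map L E) (descent S) = [::].
Proof. by rewrite last_rcons. Qed.

Lemma descent_uniq S : uniq (W :: descent S).
Proof.
rewrite /= rcons_uniq words_of_uniq mem_rcons in_cons negb_or andbT -andbA.
apply/and3P; split.
- by rewrite -size_eq0 -lt0n (leq_trans _ size_universal_word).
- apply/negP=> /words_ofP[x _ def_W]; have := size_universal_word.
  by rewrite def_W ltnNge size_word_of.
- by apply/negP=> /words_ofP[x _ def_x]; have := size_word_of_gt0 x; rewrite -def_x.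
Qed.

Lemma pi_perm S : totally_ordered S -> perm_eq (pi S) E.
Proof.
move=> totS; apply: deletions_perm (descent_path totS) (descent_last S).
exact: sorted_iota.
Qed.

Lemma pi_passes S : totally_ordered S ->
  {in descent S, forall g, passes L E (pi S) g}.
Proof. by move=> totS; apply: deletions_passes sorted_iota (descent_path totS). Qed.

Lemma pi_passes_word S x : totally_ordered S -> x \in S ->
  passes L E (pi S) (word_of x).
Proof.
move=> totS Sx; apply: pi_passes => //.
by rewrite mem_rcons in_cons mem_words_of Sx orbT.
Qed.

Lemma pi_min S S' : totally_ordered S -> totally_ordered S' ->
  {in S, forall x, passes L E (pi S') (word_of x)} -> (pi S <= pi S')%O.
Proof.
move=> totS totS' passS.
apply: deletions_min sorted_iota (descent_path totS) (pi_perm totS') _ => g.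
rewrite mem_rcons in_cons => /predU1P[->|/words_ofP[x Sx ->]]; last exact: passS.
by apply: pi_passes; rewrite // mem_rcons mem_head.
Qed.

Lemma piS S S' : S \subset S' -> totally_ordered S' -> (pi S <= pi S')%O.
Proof.
move=> sSS' totS'; apply: pi_min => // [|x Sx]; first exact: totally_orderedS totS'.
by apply: pi_passes_word => //; exact: (subsetP sSS').
Qed.

(** These are the words that can be inserted in a chain with order of deletion s, or removed from
    it, without changing s. *)
Definition is_pivot (s : seqlexi nat) x :=
  passes L E s (word_of x) && ascent E s (size (word_of x)).

(** A chain with fewer than [#|T|] elements misses a rank t of T. Its order of deletion ascends at
    t, and the word of length t that it meets is a pivot. *)
Lemma pivot_exists S : totally_ordered S -> (#|S| < #|T|)%N ->
  exists x, is_pivot (pi S) x.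
Proof.
move=> totS ltST; have : ~~ (T \subset rank_of @: S).
  apply/negP=> /subset_leq_card leT.
  by have := leq_trans leT (leq_imset_card _ _); rewrite leqNgt ltST.
case/subsetPn=> t Tt Sxt.
have t_gt0 : (0 < t)%N.
  rewrite lt0n; apply: contraNneq T_pos => t0.
  by rewrite (_ : ord0 = t) //; apply: val_inj.
have ltt : (t < size W)%N by apply: leq_trans (ltn_ord t) size_universal_word.
have asc : ascent E (pi S) t.
  apply: deletions_ascent sorted_iota (descent_path totS) (descent_last S) _ _.
    rewrite /descent map_rcons mem_rcons in_cons negb_or -lt0n t_gt0.
    apply/mapP=> -[_ /words_ofP[x Sx ->] def_t]; case/imsetP: Sxt.
    by exists x => //; apply: val_inj.
  by rewrite t_gt0 size_iota.
pose E' := removed E (take (size E - t) (pi S)).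
have sz_s : size (map L E') = t.
  have permE := pi_perm totS; have uE : uniq E := iota_uniq 0 _.
  have upi : uniq (pi S) by rewrite (perm_uniq permE).
  have : perm_eq (take (size E - t) (pi S) ++ E') E.
    apply: uniq_perm => // [|i].
      rewrite cat_uniq take_uniq // filter_uniq // andbT -all_predC.
      by apply/allP=> i; rewrite mem_filter /= => /andP[].
    rewrite mem_cat mem_filter; case: (boolP (i \in take _ _)) => //= /mem_take.
    by rewrite (perm_mem permE).
  move/perm_size; rewrite size_cat size_map size_takel; rewrite ?size_iota.
    move=> eq_sz; apply/eqP; rewrite -(eqn_add2l (size W - t)) eq_sz.
    by rewrite (subnK (ltnW ltt)).
  by rewrite (perm_size permE) size_iota leq_subr.
have [x def_x] := rank_word_of_seq Tt sz_s.
exists x; rewrite /is_pivot def_x sz_s asc andbT /passes sz_s.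
exact: eqxx.
Qed.

(** [pi S] already meets x, so minimality bounds [pi (x |: S)] by [pi S]; adding a word cannot lower
    [pi]. *)
Lemma pivot_add S x : totally_ordered S -> is_pivot (pi S) x ->
  totally_ordered (x |: S) /\ pi (x |: S) = pi S.
Proof.
move=> totS /andP[pass_x _].
have pass y : y \in x |: S -> passes L E (pi S) (word_of y).
  by rewrite in_setU1 => /predU1P[->//|Sy]; exact: pi_passes_word.
have totU : totally_ordered (x |: S).
  apply/totally_orderedP=> y z Uy Uz; rewrite /Order.comparable !le_rank_wordE.
  have [le_yz|/ltnW le_zy] := leqP (size (word_of y)) (size (word_of z)).
    by rewrite (passes_subseq (pass y Uy) (pass z Uz)).
  by rewrite (passes_subseq (pass z Uz) (pass y Uy)) ?orbT.
split=> //; apply/le_anti; rewrite pi_min //=.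
by rewrite piS ?subsetU1.
Qed.

Lemma pivot_del S x : totally_ordered S -> is_pivot (pi S) x -> x \in S ->
  pi (S :\ x) = pi S.
Proof.
move=> totS /andP[_ asc_x] Sx.
have totD : totally_ordered (S :\ x) by exact: totally_orderedS (subD1set _ _) totS.
have xw : word_of x \in words_of S by rewrite mem_words_of.
have srtS := words_of_sorted totS; have uS := descent_uniq S.
have pS := descent_path totS; have uw := words_of_uniq S.
have wD : words_of (S :\ x) = rem (word_of x) (words_of S).
  apply: (sorted_eq (@supseq_trans A)).
  - by move=> u v /andP[uv vu]; apply: subseq_anti; rewrite [subseq u v]vu.
  - exact: words_of_sorted.
  - exact: (subseq_sorted (@supseq_trans A) (rem_subseq _ _) srtS).
  apply: uniq_perm; rewrite ?rem_uniq ?words_of_uniq // => g.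
  rewrite mem_rem_uniq // inE.
  apply/words_ofP/andP => [[y]|[gx /words_ofP[y Sy def_g]]].
    by rewrite !inE => /andP[nyx Sy] ->; rewrite mem_words_of Sy.
  by exists y; rewrite // !inE Sy andbT -(inj_eq word_of_inj) -def_g.
rewrite /chain_deletions /descent wD.
move: pS uS asc_x; rewrite /chain_deletions /descent.
case/splitPr: xw uw {wD srtS} => l l' uw pS uS asc_x.
have xl : word_of x \notin l.
  by move: uw; rewrite uniq_catC cat_cons /= mem_cat negb_or => /andP[/andP[]].
have -> : rem (word_of x) (l ++ word_of x :: l') = l ++ l'.
  rewrite remE index_cat (negPf xl) /= eqxx addn0 take_size_cat //.
  by rewrite -cat_rcons drop_size_cat ?size_rcons.
move: pS uS asc_x; rewrite !rcons_cat rcons_cons.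
(* The empty word at the end provides a successor g of x in the sequence. *)
case def_gs: (rcons l' [::]) => [|g gs]; first by case: (l') def_gs.
move=> pS uS asc_x; apply/esym/deletions_del_cat => //; first exact: sorted_iota.
have lt_size (u v : seq A) : supseq u v -> v != u -> (size v < size u)%N.
  by move=> /size_subseq_leqif/ltn_leqif->.
move: (pS); rewrite cat_path [path _ (last _ _) _]/= => /and4P[_ lx xg _].
apply/andP; split; apply: lt_size => //.
  apply: contraTneq uS => ->; rewrite /= cat_uniq /= mem_head !andbF //.
apply: contraTneq uS => eq_x; move: (mem_last W l); rewrite -word_iota -eq_x.
rewrite word_iota -cat_cons cat_uniq negb_and => xWl.
by rewrite [has _ _]/= [_ \in _]xWl /= orbT.
Qed.

Lemma rank_word_exact : exact_below X #|T|.
Proof.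
have [x0 _|X0] := pickP (fun x : X => true); last first.
  move=> m z ltm chz _; have [t Tt] : exists t, t \in T.
    by apply/card_gt0P; apply: leq_ltn_trans ltm.
  have [x _] := rank_word_of_seq Tt (size_nseq t a0).
  by have := X0 x.
(* Counting the smaller orders of deletion turns the lexicographic order into a numerical
   potential. *)
pose p S := #|[set S' | (pi S' < pi S)%O]|.
have p_le S S' : (pi S <= pi S')%O -> (p S <= p S')%N.
  move=> le12; apply/subset_leq_card/subsetP=> U; rewrite !inE => lt1.
  exact: lt_le_trans lt1 le12.
have p_inj S S' : p S = p S' -> pi S = pi S'.
  have lt_p U V : (pi U < pi V)%O -> (p U < p V)%N.
    move=> ltUV; apply/proper_card/properP; split.
      by apply/subsetP=> V'; rewrite !inE => /lt_trans->.
    by exists U; rewrite !inE ?ltxx.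
  by move=> eqp; case: (ltgtP (pi S) (pi S')) => // /lt_p; rewrite eqp ltnn.
(* The pivot is chosen from [pi S] alone, so sets with equal potential share it. *)
pose v S := odflt x0 [pick x | is_pivot (pi S) x].
have vP S : totally_ordered S -> (#|S| < #|T|)%N -> is_pivot (pi S) (v S).
  move=> totS ltS; rewrite /v; case: pickP => //= none.
  by have [x] := pivot_exists totS ltS; rewrite none.
apply: (@set_complex_exact _ X p v).
- by move=> S x totS; apply/p_le/piS; rewrite ?subD1set.
- by move=> S S' _ _ /p_inj eq_pi; rewrite /v eq_pi.
- move=> S totS ltS; have [totU eq_pi] := pivot_add totS (vP S totS ltS).
  by rewrite /p eq_pi.
- by move=> S totS ltS Sv; rewrite /p pivot_del //; exact: vP.
Qed.

End WordPoset.

(** * The Hopf trace formula *)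

Section EquivariantMaps.

Variables (F : fieldType) (gT : finGroupType) (G : {group gT}).
Variables (n1 n2 : nat).
Variables (rG1 : mx_representation F G n1) (rG2 : mx_representation F G n2).
Variable f : 'M[F]_(n1, n2).
Hypothesis f_hom : forall x, x \in G -> rG1 x *m f = f *m rG2 x.

(** Equality of ranks makes f injective on V. *)
Lemma rsim_submod_image (V : 'M_n1) (W : 'M_n2)
    (modV : mxmodule rG1 V) (modW : mxmodule rG2 W) :
  (W :=: V *m f)%MS -> \rank W = \rank V ->
  mx_rsim (submod_repr modV) (submod_repr modW).
Proof.
move=> defW rankW.
have sVW : (val_submod (1%:M : 'M_(\rank V)) *m f <= W)%MS.
  by rewrite defW submxMr ?val_submod1.
exists (in_submod W (val_submod 1%:M *m f)) => // [|x Gx].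
  rewrite /row_free -[X in _ == X]rankW -[_ == _]sub1mx -val_submodS in_submodK //.
  by rewrite val_submod1 defW submxMr ?val_submod1.
rewrite -in_submodJ // -[in RHS]mulmxA -f_hom // [in RHS]mulmxA.
rewrite -(val_submodJ modV) // mul1mx.
by rewrite [in LHS]in_submodE [in RHS]in_submodE [in RHS]val_submodE !mulmxA.
Qed.

(** The first isomorphism theorem for the equivariant map f. *)
Lemma rsim_factmod_kermx (V : 'M_n1) (W : 'M_n2)
    (modV : mxmodule rG1 V) (modW : mxmodule rG2 W) :
  (V :=: kermx f)%MS -> (W :=: f)%MS ->
  mx_rsim (factmod_repr modV) (submod_repr modW).
Proof.
move=> defV defW.
have kerf m (M : 'M_(m, n1)) :
    val_factmod (in_factmod V M) *m f = M *m f.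
  rewrite -{2}[M](add_sub_fact_mod V) mulmxDl.
  have : (val_submod (in_submod V M) <= kermx f)%MS by rewrite -defV val_submodP.
  by move/sub_kermxP->; rewrite add0r.
have sfW m (M : 'M_(m, n1)) : (M *m f <= W)%MS by rewrite defW submxMl.
exists (in_submod W (val_factmod 1%:M *m f)).
- by rewrite mxrank_coker defV defW mxrank_ker subKn // rank_leq_row.
- have rankW : \rank W = \rank (cokermx V).
    by rewrite mxrank_coker defV defW mxrank_ker subKn // rank_leq_row.
  rewrite /row_free -[X in _ == X]rankW -[_ == _]sub1mx -val_submodS in_submodK //.
  rewrite val_submod1 defW -{1}[f]mul1mx -kerf val_factmodE -mulmxA.
  exact: submxMl.
move=> x Gx; rewrite -in_submodJ // -[in RHS]mulmxA -f_hom //.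
rewrite [in RHS]mulmxA -[in RHS]kerf.
rewrite -(val_factmodJ modV) // mul1mx.
by rewrite [in LHS]in_submodE [in RHS]in_submodE [in RHS]val_factmodE !mulmxA.
Qed.

End EquivariantMaps.

(** For the top degree, where there are no boundaries and the homology is the module of cycles. *)
Lemma rsim_section0 (F : fieldType) (gT : finGroupType) (G : {group gT}) n
    (rG : mx_representation F G n) (U V : 'M_n)
    (modU : mxmodule rG U) (modV : mxmodule rG V) :
  U = 0 -> mx_rsim (submod_repr modV) (section_repr modU modV).
Proof.
move=> U0; apply: (rsim_submod_image (f := in_factmod U 1%:M)).
- by move=> x Gx; rewrite -in_factmodE -[rG x]mul1mx in_factmodJ.
- by apply: eqmx_trans (genmxE _) _; rewrite in_factmodE.
have rankU : \rank U = 0 by rewrite U0 mxrank0.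
have rankUV : \rank (U + V) = \rank V by rewrite U0 adds0mx.
by rewrite genmxE -rankUV -mxrank_in_factmod rankU addn0.
Qed.

Lemma mxtrace_perm_action (gT : finGroupType) (X : finType)
    (to : {action gT &-> X}) g :
  \tr (perm_action_mx to g) = #|[set x | to x g == x]|%:R.
Proof.
rewrite /mxtrace (reindex _ (onW_bij _ (enum_rank_bij X))) /=.
rewrite -sum1dep_card natr_sum [RHS]big_mkcond /=; apply: eq_bigr => x _.
by rewrite mxE enum_rankK; case: (_ == _).
Qed.

Section HopfTrace.

Variables (disp : Order.disp_t) (X : finPOrderType disp).
Variables (gT : finGroupType) (to : {action gT &-> X}).
Hypothesis to_mono : forall g : gT, {mono to^~ g : x y / (x <= y)%O}.
Variable d : nat.
Hypothesis X_exact : exact_below X d.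
Hypothesis X_dim : #|{: chain X d.+1}| = 0.

(** Chains modulo cycles are isomorphic to boundaries, which by exactness are the cycles one degree
    lower; iteration gives the alternating sum. At m = 0 the quotient is all of [chain_repr] in
    degree 0, the augmentation being onto. *)
Lemma mxtrace_cycles m x : (m < d)%N ->
  \tr (submod_repr (cycles_module to_mono m) x) =
  \sum_(j < m.+2) (-1) ^+ (m.+1 - j) * \tr (chain_repr to_mono j x).
Proof.
have cyclesE j : \tr (submod_repr (cycles_module to_mono j) x) =
    \tr (chain_repr to_mono j.+1 x) - \tr (factmod_repr (cycles_module to_mono j) x).
  by rewrite -(mxtrace_sub_fact_mod (cycles_module to_mono j)) addrK.
elim: m => [|m IHm] ltmd; rewrite cyclesE.
  have mod1 := mxmodule1 (chain_repr to_mono 0).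
  have full0 := boundary0_full X_exact ltmd.
  have simf : mx_rsim (factmod_repr (cycles_module to_mono 0)) (submod_repr mod1).
    apply: (rsim_factmod_kermx (f := boundary X 0)) => //.
      by move=> g _; exact: boundary_chain_repr.
    by apply/eqmxP; rewrite submx1 sub1mx full0.
  rewrite (mxtrace_rsim simf) ?inE // mxtrace_submod1 ?inE //.
  by rewrite !big_ord_recl big_ord0 /= /bump /= expr1 expr0; ring.
have defB : (<<boundary X m.+1>> :=: kermx (boundary X m))%MS.
  apply/eqmxP; rewrite !genmxE (kermx_boundary X_exact) // andbT.
  by apply/sub_kermxP; exact: mul_boundary_boundary.
have simf : mx_rsim (factmod_repr (cycles_module to_mono m.+1))
                    (submod_repr (boundaries_module to_mono m)).
  apply: (rsim_factmod_kermx (f := boundary X m.+1)) => //.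
    by move=> g _; exact: boundary_chain_repr.
  exact: genmxE.
have simB : mx_rsim (submod_repr (boundaries_module to_mono m))
                    (submod_repr (cycles_module to_mono m)).
  apply: (rsim_submod_image (f := 1%:M)); last by rewrite defB.
    by move=> g _; rewrite mulmx1 mul1mx.
  by rewrite mulmx1; exact: eqmx_sym.
rewrite (mxtrace_rsim simf) ?inE // (mxtrace_rsim simB) ?inE // IHm; last exact: ltnW.
rewrite [RHS]big_ord_recr /= subnn expr0 mul1r addrC -sumrN; congr (_ + _).
apply: eq_bigr => i _; rewrite [in RHS]subSn ?exprS ?mulN1r ?mulNr //.
by rewrite -ltnS.
Qed.

Lemma mxtrace_reduced_homology x : (0 < d)%N ->
  \tr (reduced_homology to_mono d.-1 x) =
  (-1) ^+ d * \sum_(m < d.+1) (-1) ^+ m *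
    #|[set c | chain_action to_mono m c x == c]|%:R.
Proof.
move=> d_gt0; have sim := rsim_section0 (boundaries_module to_mono d.-1)
  (cycles_module to_mono d.-1) _.
rewrite -(mxtrace_rsim (sim _)) ?inE //.
  rewrite mxtrace_cycles ?prednK // big_distrr; apply: eq_bigr => j _ /=.
  rewrite mxtrace_perm_action mulrA; congr (_ * _).
  have lejd : (j <= d)%N by rewrite -ltnS.
  have -> : (-1) ^+ d = (-1) ^+ (d - j) * (-1) ^+ j :> algC.
    by rewrite -exprD subnK.
  by rewrite -mulrA -expr2 sqrr_sign mulr1.
(* There are no boundaries in the top degree: by [X_dim] the matrix has no rows. *)
apply/eqP; rewrite -mxrank_eq0 genmxE -leqn0; apply: leq_trans (rank_leq_row _) _.
by rewrite prednK // X_dim.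
Qed.

End HopfTrace.
(** * Counting chains of words *)

Arguments word_of {A k T} x.
Arguments rank_of {A k T} x.

(* Words of length k above a given word of length r, over an alphabet with
   'X + 1 letters: split according to whether the first letter is matched. *)
Fixpoint word_count (k r : nat) : {poly int} :=
  if r is r'.+1 then
    if k is k'.+1 then word_count k' r' + 'X * word_count k' r else 0
  else ('X + 1) ^+ k.

Lemma word_count0 k : word_count k 0 = ('X + 1) ^+ k.
Proof. by case: k. Qed.

(* The sum of (-1)^m over the m-chains of words with lengths in the increasing
   list ts and above a given word of length r. *)
Fixpoint euler (r : nat) (ts : seq nat) : {poly int} :=
  if ts is t :: ts' then euler r ts' - word_count t r * euler t ts' else 1.

(** The 1 is the empty chain; the other chains are grouped by the length t of their smallest
    word. *)
Lemma euler_unroll r ts : sorted ltn ts ->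
  euler r ts =
  1 - \sum_(t <- ts) word_count t r * euler t [seq t' <- ts | (t < t')%N].
Proof.
elim: ts => [|t ts IHts] srt; first by rewrite big_nil subr0.
have [srt' _ _ gtt] := sorted_ltnS srt.
rewrite [LHS]/= IHts // big_cons /= ltnn opprD addrA addrAC.
have -> : [seq t' <- ts | (t < t')%N] = ts by apply/all_filterP/allP.
congr (_ - _ - _); apply: eq_big_seq => t' /gtt ltt.
by rewrite [(t' < t)%N]ltnNge ltnW.
Qed.

Lemma big_tuple_cons (R : nmodType) (T : finType) k (G : k.+1.-tuple T -> R) :
  \sum_v G v = \sum_a \sum_(v : k.-tuple T) G [tuple of a :: v].
Proof.
rewrite pair_big /= (reindex (fun av : T * k.-tuple T => [tuple of av.1 :: av.2])) //.
exists (fun v => (thead v, [tuple of behead v])) => [[a v] _|v _] /=.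
  by congr (_, _); apply: val_inj.
by rewrite [RHS]tuple_eta.
Qed.

Section FixedWords.

Variables (A : finType) (F : {set A}).

Local Notation x := (#|F|%:R - 1 : int).
Local Notation words_above k u :=
  [set v : k.-tuple A | all (mem F) v && subseq u v].

(** Split by the first letter a of v: greedy matching consumes the head of u exactly when it is
    a. *)
Lemma card_words_aboveS k (u : seq A) :
  #|words_above k.+1 u| = (\sum_(a in F)
    #|words_above k (if ohead u == Some a then behead u else u)|)%N.
Proof.
have cardE j w : #|words_above j w| =
    (\sum_(v : j.-tuple A) (all (mem F) v && subseq w v))%N.
  by rewrite -sum1dep_card big_mkcond; apply: eq_bigr => v _; case: ifP.
rewrite cardE big_tuple_cons [RHS]big_mkcond; apply: eq_bigr => a _ /=.
case: ifP => Fa; last by rewrite big1.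
rewrite cardE; apply: eq_bigr => v _; rewrite andTb; congr (_ && _ : nat).
case: u => [|y u]; first by rewrite sub0seq.
by rewrite (_ : (Some y == Some a) = (y == a)) //; case: ifP.
Qed.

(** One letter of F matches the head of u and the other [#|F| - 1] do not, so only the length of u
    matters. *)
Lemma card_words_above k (u : seq A) : all (mem F) u ->
  #|words_above k u|%:R = (word_count k (size u)).[x].
Proof.
elim: k u => [|k IHk] u Fu.
  case: u Fu => [|y u] Fu /=.
    rewrite expr0 hornerC (_ : #|_| = 1) //.
    apply: etrans (card_tuple 0 A) => //; apply: eq_card => v.
    by rewrite !inE sub0seq andbT [v]tuple0.
  rewrite horner0 (_ : #|_| = 0) //; apply: eq_card0 => v.
  by rewrite !inE [v]tuple0 andbF.
rewrite card_words_aboveS natr_sum; case: u Fu => [|y u] /=.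
  move=> _; under eq_bigr do rewrite IHk //=.
  by rewrite sumr_const -mulr_natl word_count0 exprS !hornerE subrK mulr_natl.
case/andP=> Fy Fu; rewrite (bigD1 y) //= eqxx IHk // hornerD hornerM hornerX.
congr (_ + _); rewrite (eq_bigr (fun=> (word_count k (size u).+1).[x])).
  rewrite sumr_const -[LHS]mulr_natl (_ : #|_|%:R = #|F|%:R - 1 :> int) //.
  rewrite [#|F|](cardD1 y) [y \in F]Fy natrD addrAC subrr add0r; congr (_%:R).
  by apply: eq_card => a; rewrite !inE andbC.
move=> a /andP[_ nay]; rewrite (_ : (Some y == Some a) = (y == a)) // eq_sym.
by rewrite (negPf nay) IHk //= Fy.
Qed.

End FixedWords.

Section FixedChains.

Variables (A : finType) (k : nat) (T : {set 'I_k.+1}) (F : {set A}).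
Hypothesis T_pos : ord0 \notin T.

Local Notation X := (rank_word A T).
Local Notation x := (#|F|%:R - 1 : int).
Local Notation fixed w := (all (mem F) w).

Definition strictly_above (u v : seq A) := subseq u v && (size u < size v)%N.

Fixpoint chains_above m (u : seq A) : nat :=
  if m is m'.+1 then
    \sum_(w : X | fixed (word_of w) && strictly_above u (word_of w))
      chains_above m' (word_of w)
  else 1.

Lemma card_paths_above m u :
  #|[set t : m.-tuple X | all (fun w => fixed (word_of w)) t &&
      path strictly_above u (map word_of t)]| = chains_above m u.
Proof.
have cardE j w : #|[set t : j.-tuple X | all (fun w => fixed (word_of w)) t &&
    path strictly_above w (map word_of t)]| =
    (\sum_(t : j.-tuple X) (all (fun w => fixed (word_of w)) t &&
       path strictly_above w (map word_of t)))%N.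
  by rewrite -sum1dep_card big_mkcond; apply: eq_bigr => v _; case: ifP.
elim: m u => [|m IHm] u.
  by rewrite cardE (big_pred1 [tuple]) // => t; rewrite [t]tuple0; exact/esym/eqP.
rewrite cardE big_tuple_cons [RHS]/= [RHS]big_mkcond; apply: eq_bigr => w _ /=.
case: ifP => [/andP[-> ->]|nFw]; last first.
  by rewrite big1 // => t _; rewrite andbACA nFw.
by rewrite -IHm cardE.
Qed.

Lemma lt_rank_wordE (w w' : X) :
  (w < w')%O = strictly_above (word_of w) (word_of w').
Proof.
rewrite lt_neqAle le_rank_wordE -(inj_eq (@word_of_inj A k T)) andbC.
rewrite /strictly_above; have [sub_ww'|//] := boolP (subseq _ _).
by rewrite (ltn_leqif (size_subseq_leqif sub_ww')).
Qed.

Lemma sorted_path_words (t : seq X) :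
  sorted <%O t = path strictly_above [::] (map word_of t).
Proof.
case: t => //= w t; rewrite {1}/strictly_above sub0seq size_word_of_gt0 //=.
by elim: t w => //= w' t IHt w; rewrite lt_rank_wordE IHt.
Qed.

Lemma card_fixed_chains m :
  #|[set c : chain X m | all (fun w => fixed (word_of w)) (val c)]| =
  chains_above m [::].
Proof.
rewrite -card_paths_above -(card_imset _ val_inj); apply: eq_card => t.
rewrite !inE -sorted_path_words; apply/imsetP/andP => [[c]|[Ft srt]].
  by rewrite inE => Fc ->; split; [exact: Fc | exact: valP c].
by exists (exist _ t srt); rewrite ?inE.
Qed.

Definition rank_seq := [seq val t | t <- enum T].

Lemma rank_seq_sorted : sorted ltn rank_seq.
Proof.
apply: (subseq_sorted ltn_trans (map_subseq val (filter_subseq _ _))).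
by rewrite -enumT val_enum_ord iota_ltn_sorted.
Qed.

Lemma card_rank_words u (t : 'I_k.+1) : t \in T -> fixed u ->
  #|[set w : X | [&& rank_of w == t, fixed (word_of w) & subseq u (word_of w)]]|%:R
    = (word_count t (size u)).[x].
Proof.
move=> Tt Fu; rewrite -card_words_above //; congr (_%:R).
have szt (v : t.-tuple A) : (size v <= k)%N by rewrite size_tuple -ltnS.
have Tv (v : t.-tuple A) :
    Ordinal (size_bseq (Bseq (szt v)) : size (Bseq (szt v)) < k.+1)%N \in T.
  rewrite (_ : Ordinal _ = t) //.
  by apply: val_inj; rewrite /= size_tuple.
pose h (v : t.-tuple A) : X := exist _ (Bseq (szt v)) (Tv v).
have h_inj : injective h.
  by move=> v v' /(congr1 word_of) eq_v; apply: val_inj.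
rewrite -(card_imset _ h_inj); apply: eq_card => w; rewrite inE.
apply/and3P/imsetP => [[/eqP def_t Fw uw]|[v]]; last first.
  rewrite inE => /andP[Fv uv] ->; split=> //.
  by apply/eqP/val_inj; rewrite /= size_tuple.
have sz_w : size (word_of w) == t by rewrite -def_t.
by exists (Tuple sz_w); [rewrite inE Fw | apply: word_of_inj].
Qed.

(** M bounds the ranks available above u, hence the lengths of chains. Removing the smallest word w
    of a chain changes the sign and leaves fewer ranks above w. *)
Lemma euler_chains M u : fixed u ->
    (#|[set t in T | (size u < t)%N]| <= M)%N ->
  \sum_(m < M.+1) (-1) ^+ m * (chains_above m u)%:R =
  (euler (size u) [seq t <- rank_seq | (size u < t)%N]).[x].
Proof.
elim: M u => [|M IHM] u Fu leM.
  rewrite big_ord_recl big_ord0 /= mulr1 addr0.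
  have -> : [seq t <- rank_seq | (size u < t)%N] = [::].
    apply/eqP; rewrite -[_ == _]negbK -has_filter; apply/hasPn=> _ /mapP[t + ->].
    rewrite mem_enum => Tt; apply/negP=> ltt; move: leM.
    by rewrite leqn0 cards_eq0 => /eqP/setP/(_ t); rewrite !inE Tt ltt.
  by rewrite hornerC expr0.
rewrite big_ord_recl /= expr0 mul1r.
transitivity (1 - \sum_(w : X | fixed (word_of w) && strictly_above u (word_of w))
    \sum_(m < M.+1) (-1) ^+ m * (chains_above m (word_of w))%:R : int).
  rewrite exchange_big /= -sumrN; congr (_ + _); apply: eq_bigr => m _.
  by rewrite /bump /= add1n exprS mulN1r mulNr natr_sum big_distrr.
rewrite (eq_bigr (fun w : X => (euler (rank_of w)
    [seq t <- rank_seq | (rank_of w < t)%N]).[x])) => [|w /andP[Fw /andP[_ ltuw]]].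
  rewrite euler_unroll; last exact: (sorted_filter ltn_trans _ rank_seq_sorted).
  rewrite hornerD hornerN horner_sum hornerC; congr (_ - _).
  rewrite big_filter big_map /rank_seq big_enum_cond /=.
  (* The inner sum depends only on the rank of w, so words of equal rank are counted together. *)
  rewrite (partition_big rank_of (fun t => (t \in T) && (size u < t)%N)) /=.
    apply: eq_bigr => t /andP[Tt ltut].
    rewrite hornerM -(card_rank_words Tt Fu) -filter_predI.
    have -> : [seq t' <- rank_seq |
          predI (fun t' => (t < t')%N) (fun t' => size u < t')%N t']
        = [seq t' <- rank_seq | (t < t')%N].
      apply: eq_filter => t' /=; case: (ltnP t t') => //= ltt.
      exact: ltn_trans ltut ltt.
    rewrite mulr_natl (eq_bigr (fun=> (euler t
      [seq t' <- rank_seq | (t < t')%N]).[x])) => [|w /andP[_ /eqP<-] //].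
    rewrite sumr_const; congr (_ *+ _); apply: eq_card => w.
    rewrite [LHS]unfold_in inE /strictly_above.
    case: eqP => [def_t|]; rewrite ?andbF //=.
    have ltuw : (size u < size (word_of w))%N by move: ltut; rewrite -def_t.
    by rewrite ltuw !andbT.
  by move=> w /andP[_ /andP[_ ltuw]]; rewrite rank_of_in.
rewrite IHM //; rewrite -ltnS; apply: leq_trans leM; apply/proper_card/properP; split.
  apply/subsetP=> t; rewrite !inE => /andP[-> ltwt].
  exact: ltn_trans ltuw ltwt.
by exists (rank_of w); rewrite !inE rank_of_in ?ltnn.
Qed.

Lemma euler_fixed_chains :
  \sum_(m < #|T|.+1) (-1) ^+ m *
    #|[set c : chain X m | all (fun w => fixed (word_of w)) (val c)]|%:R =
  (euler 0 rank_seq).[x].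
Proof.
under eq_bigr do rewrite card_fixed_chains.
rewrite euler_chains //; last first.
  by apply/subset_leq_card/subsetP=> t; rewrite inE => /andP[].
congr (euler _ _).[_]; apply/all_filterP/allP=> _ /mapP[t + ->].
rewrite mem_enum lt0n => Tt; apply: contraNneq T_pos => t0.
by rewrite (_ : ord0 = t) //; apply: val_inj.
Qed.

End FixedChains.

Arguments rank_seq {k} T.

(** The polynomial P_T whose value at x = f - 1 is the character of the homology, f being the number
    of fixed letters. *)
Definition rank_poly k (T : {set 'I_k.+1}) : {poly int} :=
  (-1) ^+ #|T| * euler 0 (rank_seq T).

(** * The homology character as a polynomial in the number of fixed letters *)

Section HomologyCharacter.

Variables (A : finType) (k : nat) (T : {set 'I_k.+1}) (a0 : A).
Hypotheses (T_pos : ord0 \notin T) (T_neq0 : T != set0).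

Lemma chain_rank_bound : #|{: chain (rank_word A T) #|T|.+1}| = 0.
Proof.
apply: eq_card0 => c; apply/negP=> _.
have rank_inj : {in chain_support c &, injective rank_of}.
  move=> w w' cw cw' eq_r; apply: word_of_inj.
  have /totally_orderedP/(_ w w' cw cw') := chain_support_totally_ordered c.
  have szE : size (word_of w) = size (word_of w') by have /(congr1 val) := eq_r.
  rewrite /Order.comparable !le_rank_wordE => /orP[] /size_subseq_leqif[_ ];
  by rewrite szE eqxx => /esym/eqP.
have : (#|rank_of @: chain_support c| <= #|T|)%N.
  by apply/subset_leq_card/subsetP=> _ /imsetP[w _ ->]; exact: rank_of_in.
by rewrite card_in_imset // card_chain_support ltnn.
Qed.

(** The Hopf trace formula counts chains fixed by g. Such a chain is fixed word by word, and a word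
    is fixed when all its letters are, so these are the chains over the fixed letters. *)
Lemma homology_charE (g : {perm A}) :
  homology_char A T g = (rank_poly T).[#|[set a | g a == a]|%:R - 1]%:~R.
Proof.
set F := [set a | g a == a].
rewrite cfunE in_setT mulr1n /rank_homology.
rewrite (mxtrace_reduced_homology (@word_action_mono A k T) (rank_word_exact a0 T_pos)
  chain_rank_bound) ?card_gt0 //.
rewrite /rank_poly hornerM -(euler_fixed_chains F T_pos) rmorphM /=.
have -> : ((-1) ^+ #|T| : {poly int}).[#|F|%:R - 1] = (-1) ^+ #|T|.
  by rewrite -polyC1 -polyCN -polyC_exp hornerC.
rewrite rmorphXn rmorphN1 rmorph_sum; congr (_ * _); apply: eq_bigr => m _.
rewrite rmorphM rmorphXn rmorphN1 rmorph_nat; congr (_ * _%:R).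
apply: eq_card => c; rewrite !inE -val_eqE -val_eqE /=.
have fixE (w : rank_word A T) :
    (word_action A T w g == w) = all (mem F) (word_of w).
  rewrite -(inj_eq (@word_of_inj A k T)) /word_of /=.
  elim: (val (val w)) => //= a s <-; rewrite inE eqseq_cons //.
elim: (tval (val c)) => //= w s <-; rewrite eqseq_cons -fixE //.
Qed.

End HomologyCharacter.
(** * Nonnegativity of the chain polynomials *)

Lemma word_count_small k r : (k < r)%N -> word_count k r = 0.
Proof.
elim: k r => [|k IHk] [|r] //=; rewrite ltnS => ltkr.
by rewrite !IHk ?mulr0 ?addr0 // ltnW.
Qed.

Lemma word_count_id k : word_count k k = 1.
Proof.
elim: k => [|k IHk] /=; first by rewrite expr0.
by rewrite IHk word_count_small ?mulr0 ?addr0.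
Qed.

(** At x = 0 the alphabet has one letter, and there is one word of each length. *)
Lemma word_count_at0 k r : (word_count k r).[0] = (r <= k)%N%:R.
Proof.
by elim: k r => [|k IHk] [|r] /=; rewrite ?hornerE //= ?expr1n.
Qed.

(** Over one letter the words are totally ordered, so a nonempty set of ranks gives a contractible
    complex. *)
Lemma euler_at0 r ts : path leq r ts -> (euler r ts).[0] = (ts == [::])%:R.
Proof.
elim: ts r => [|t ts IHts] r /=; first by rewrite hornerE.
case/andP=> lert pts; have prs : path leq r ts.
  by case: ts pts {IHts} => //= t' ts /andP[letT ->]; rewrite (leq_trans lert).
by rewrite hornerD hornerN hornerM word_count_at0 lert !IHts // mul1r subrr.
Qed.

(** At x = -1 the alphabet is empty, and only the empty chain remains. *)
Lemma euler_atN1 ts : 0 \notin ts -> (euler 0 ts).[-1] = 1.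
Proof.
elim: ts => [|t ts IHts] /=; first by rewrite hornerE.
rewrite in_cons negb_or eq_sym -lt0n => /andP[t_gt0 /IHts IH].
rewrite hornerD hornerN hornerM IH word_count0 !hornerE addNr expr0n gtn_eqF //.
by rewrite mul0r subr0.
Qed.

(** For i = 0 this is the binomial theorem for - 'X + ('X + 1). Otherwise Pascal's rule splits the
    sum: the recursion of [word_count] turns one half into the cases i and i.+1 at k, and the other
    half cancels the case i.+1. *)
Lemma word_count_binomial i k :
  \sum_(j < k.+1) word_count j i * (- 'X) ^+ (k - j) *+ 'C(k, j) = (i <= k)%N%:R.
Proof.
elim: k i => [|k IHk] [|i].
- by rewrite big_ord_recl big_ord0 /= !expr0 mulr1 addr0.
- by rewrite big_ord_recl big_ord0 /= mul0r addr0.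
- rewrite leq0n; apply: etrans (expr1n _ k.+1).
  have -> : 1 = - 'X + ('X + 1) :> {poly int} by rewrite addKr.
  rewrite exprDn; apply: eq_bigr => j _.
  by rewrite word_count0 mulrC.
pose G j := word_count j.+1 i.+1 * (- 'X) ^+ (k - j) : {poly int}.
have GE : \sum_(j < k.+1) G j *+ 'C(k, j) =
    (i <= k)%N%:R + 'X * (i.+1 <= k)%N%:R.
  rewrite -!IHk big_distrr -big_split; apply: eq_bigr => j _ /=.
  by rewrite mulrnAr -mulrnDl mulrA -mulrDl.
have GE' : \sum_(j < k.+1) G j *+ 'C(k, j.+1) = - ('X * (i.+1 <= k)%N%:R).
  rewrite big_ord_recr /= bin_small // mulr0n addr0 -IHk big_ord_recl /=.
  rewrite mul0r mul0rn add0r big_distrr -sumrN /=.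
  apply: eq_bigr => j _; rewrite /bump /= add1n /G.
  rewrite -{1}(subnSK (ltn_ord j)) exprS mulrnAr -mulNrn; congr (_ *+ _) => /=; ring.
rewrite big_ord_recl [word_count _ _]/= mul0r mul0rn add0r.
under eq_bigr do rewrite lift0 subSS binS mulrnDr -/(G _).
by rewrite big_split /= GE GE' addrC addrK ltnS.
Qed.

Lemma word_count_binomial_tail r k : (r <= k)%N ->
  1 - \sum_(r.+1 <= j < k.+1) word_count j r * (- 'X) ^+ (k - j) *+ 'C(k, j) =
  (- 'X) ^+ (k - r) *+ 'C(k, r).
Proof.
move=> lerk; have := word_count_binomial r k; rewrite -(big_mkord xpredT (fun j =>
  word_count j r * (- 'X) ^+ (k - j) *+ 'C(k, j))) lerk.
rewrite (@big_cat_nat _ _ _ r) //=; last exact: leqW.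
rewrite big_nat_cond big1 => [|j /andP[/andP[_ ltjr] _]]; last first.
  by rewrite word_count_small ?mul0r ?mul0rn.
rewrite add0r big_ltn // word_count_id mul1r => eq1.
by rewrite -[1]/(true%:R) -eq1 addrK.
Qed.

(** Induction on the length of the interval: the factor [euler m] for the ranks above m is, by
    [word_count_binomial_tail], the coefficient in the summand j = m. *)
Lemma euler_iota i m k : (m <= k.+1)%N ->
  euler i (iota m (k.+1 - m)) =
  1 - \sum_(m <= j < k.+1) word_count j i * (- 'X) ^+ (k - j) *+ 'C(k, j).
Proof.
move def_d: (k.+1 - m)%N => d; elim: d m i def_d => [|d IHd] m i def_d lemk.
  by rewrite big_geq ?subr0 // -subn_eq0 def_d.
have ltmk : (m < k.+1)%N by rewrite -subn_gt0 def_d.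
have def_d' : (k.+1 - m.+1 = d)%N by rewrite subnS def_d.
rewrite /= !IHd // [in RHS]big_ltn // word_count_binomial_tail //.
by rewrite mulrnAr opprD addrA addrAC.
Qed.

Lemma euler_tail k r : (r <= k)%N ->
  euler r (iota r.+1 (k - r)) = (- 'X) ^+ (k - r) *+ 'C(k, r).
Proof. by move=> lerk; rewrite -subSS euler_iota // word_count_binomial_tail. Qed.

(** Isolates the chains through length t. They factor at their word of length t into a part ending
    there, counted by the difference, and a part above it. *)
Lemma euler_cat i s t s' : euler i (s ++ t :: s') =
  euler i (s ++ s') + (euler i (rcons s t) - euler i s) * euler t s'.
Proof.
elim: s i => [|a s IHs] i /=; first by ring.
by rewrite !IHs; ring.
Qed.

Local Notation nonneg := (polyOver (@Num.Def.nneg_num_pred int)).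

(** The value is a truncation G r k of the binomial expansion of (('X + 1) - 'X)^k, and Pascal's
    rule yields a recurrence whose coefficients become nonnegative once the sign is included. *)
Lemma euler_interval_nonneg k r : (r <= k)%N ->
  (-1) ^+ (k.+1 - r) * euler 0 (iota r (k.+1 - r)) \is a nonneg.
Proof.
move=> lerk; rewrite euler_iota; last exact: leqW.
pose G r k : {poly int} :=
  \sum_(0 <= j < r) ('X + 1) ^+ j * (- 'X) ^+ (k - j) *+ 'C(k, j).
have Gk l : G l.+1 l = 1.
  have := word_count_binomial 0 l; rewrite -(big_mkord xpredT (fun j =>
    word_count j 0 * (- 'X) ^+ (l - j) *+ 'C(l, j))) leq0n => eq1.
  by rewrite -[RHS]/(true%:R) -eq1; apply: eq_bigr => j _; rewrite word_count0.
have -> : 1 - \sum_(r <= j < k.+1) word_count j 0 * (- 'X) ^+ (k - j) *+ 'C(k, j)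
    = G r k.
  under eq_bigr do rewrite word_count0.
  by rewrite -[X in X - _](Gk k) /G (@big_cat_nat _ _ _ r) /= ?addrK //; exact: leqW.
have GS s l : G s.+1 l.+1 = ('X + 1) * G s l - 'X * G s.+1 l.
  rewrite {1}/G big_nat_recl // bin0 expr0 mul1r subn0.
  under eq_bigr do rewrite binS mulrnDr subSS.
  rewrite big_split /= addrA addrC; congr (_ + _).
    rewrite /G big_distrr; apply: eq_bigr => j _ /=.
    by rewrite exprS mulrnAr mulrA.
  rewrite /G big_nat_recl // bin0 expr0 mul1r subn0 mulrDr opprD exprS mulNr.
  rewrite mulr1n; congr (_ + _); rewrite big_distrr -sumrN; apply: eq_bigr => j _ /=.
  have [ltjl|lelj] := ltnP j l; last by rewrite bin_small // !mulr0n mulr0 oppr0.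
  rewrite -{1}(subnSK ltjl) [(- 'X) ^+ _.+1]exprS mulrnAr -mulNrn.
  by congr (_ *+ _); ring.
have Xp1 : 'X + 1 \is a nonneg by rewrite rpredD ?polyOverX ?rpred1.
(* The range is widened to r <= k + 1, because the recurrence for G r.+1 k.+1 calls G r.+1 k. *)
elim: k r {lerk} (leqW lerk) => [|k IHk] [|r] le_r.
- by rewrite /G big_geq // mulr0 rpred0.
- by case: r le_r => [|//] _; rewrite Gk mulr1 expr0 rpred1.
- by rewrite /G big_geq // mulr0 rpred0.
rewrite ltnS in le_r; have [ltrk|] := ltnP r k.+1; last first.
  move=> lekr; have -> : r = k.+1 by apply/eqP; rewrite eqn_leq le_r.
  by rewrite subnn Gk mulr1 rpred1.
have -> : (-1) ^+ (k.+2 - r.+1) * G r.+1 k.+1 =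
    ('X + 1) * ((-1) ^+ (k.+1 - r) * G r k) + 'X * ((-1) ^+ (k.+1 - r.+1) * G r.+1 k).
  by rewrite GS !subSS [(k.+1 - r)%N]subSn // !exprS; ring.
by rewrite rpredD // rpredM ?IHk ?polyOverX // ltnW.
Qed.

(** [euler_cat] is solved for the punctured interval; all its other terms are intervals evaluated by
    [euler_tail]. *)
Lemma euler_punctured k r : (0 < r <= k)%N ->
  (-1) ^+ k.-1 * euler 0 (iota 1 r.-1 ++ iota r.+1 (k - r)) =
  'X^k *+ ('C(k, r)).-1 + 'X^(k.-1) *+ 'C(k, r).
Proof.
case/andP=> r_gt0 lerk; have k_gt0 := leq_trans r_gt0 lerk.
have full m : euler 0 (iota 1 m) = (- 'X) ^+ m.
  by have := euler_tail (leq0n m); rewrite subn0 bin0.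
have def_k : iota 1 k = iota 1 r.-1 ++ r :: iota r.+1 (k - r).
  rewrite {1}(_ : k = r.-1 + (k - r).+1)%N; last by lia.
  by rewrite iotaD /= add1n prednK.
have def_r : rcons (iota 1 r.-1) r = iota 1 r.
  by rewrite -cats1 -[in RHS](prednK r_gt0) -[r.-1.+1]addn1 iotaD /= add1n prednK.
have := euler_cat 0 (iota 1 r.-1) r (iota r.+1 (k - r)).
rewrite -def_k def_r !full euler_tail // => /eqP; rewrite -subr_eq => /eqP <-.
(* These substitutions remove subtractions and predecessors, leaving a polynomial identity. *)
have [j def_j] : exists j, r = j.+1 by exists r.-1; rewrite prednK.
have [l def_l] : exists l, k = (j + l).+1 by exists (k - r)%N; lia.
have [c def_c] : exists c, 'C(k, r) = c.+1.
  by exists ('C(k, r)).-1; rewrite prednK // bin_gt0.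
rewrite def_c def_j def_l /= (_ : (j + l).+1 - j.+1 = l)%N; last by lia.
have Xm m : (-1) ^+ m * (- 'X) ^+ m = 'X^m :> {poly int}.
  by rewrite -exprMn mulN1r opprK.
transitivity ((-1) ^+ (j + l) * (- 'X) ^+ (j + l) * ('X *+ c + 1 *+ c.+1) : {poly int}).
  by rewrite -addSn !exprD !exprS; ring.
by rewrite Xm exprS; ring.
Qed.

Lemma euler_pair_nonneg a b : (a < b)%N -> euler 0 [:: a; b] \is a nonneg.
Proof.
pose p : {poly int} := 'X + 1.
pose R a b := 1 - p ^+ a - p ^+ b + p ^+ a * word_count b a.
have -> : euler 0 [:: a; b] = R a b by rewrite /= !word_count0 /R -/p; ring.
have Xp : p \is a nonneg by rewrite rpredD ?polyOverX ?rpred1.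
have p1 m : p ^+ m - 1 \is a nonneg.
  by elim: m => [|m IHm]; rewrite ?subrr ?rpred0 // exprS mulrDl mul1r -addrA
    rpredD // rpredM ?polyOverX ?rpredX.
(* On the diagonal R a a = 1 - p ^+ a has the wrong sign. The added term compensates for it exactly
   there, so that the induction can pass through a = b. *)
suff: (a <= b)%N -> R a b + (p ^+ a - 1) *+ (a == b) \is a nonneg.
  by move=> nnR ltab; have := nnR (ltnW ltab); rewrite (ltn_eqF ltab) mulr0n addr0.
elim: b a => [|b IHb] [|a] leab //.
- by rewrite (_ : _ + _ = 0) ?rpred0 // /R /= !expr0 subrr mul0rn; ring.
- by rewrite /R word_count0 expr0 mul1r subrr sub0r addNr add0r mulr0n rpred0.
have RS : R a.+1 b.+1 = p * R a b + 'X * R a.+1 b + 'X * (p ^+ a.+1 + p ^+ b - 2%:R).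
  by rewrite /R /= !exprS /p; ring.
rewrite ltnS in leab; have [ltab|leba] := ltnP a b.
  have := IHb a.+1 ltab; have := IHb a leab; rewrite (ltn_eqF ltab) mulr0n addr0.
  rewrite eqSS (ltn_eqF ltab) mulr0n addr0 => Rab RSab.
  case: eqP RSab => [def_b|_] RSab; rewrite ?mulr0n ?addr0 in RSab.
    rewrite mulr1n in RSab; rewrite RS.
    (* When b = a.+1, the correction required by R a.+1 b is taken from the last term of the
       recurrence. *)
    have -> : p * R a b + 'X * R a.+1 b + 'X * (p ^+ a.+1 + p ^+ b - 2%:R) =
      p * R a b + 'X * (R a.+1 b + (p ^+ a.+1 - 1)) + 'X * (p ^+ b - 1) by ring.
    by apply: rpredD; [apply: rpredD|]; apply: rpredM; rewrite ?polyOverX.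
  rewrite RS (_ : _ - 2%:R = (p ^+ a.+1 - 1) + (p ^+ b - 1)); last by ring.
  apply: rpredD; [apply: rpredD|]; apply: rpredM; rewrite ?polyOverX //.
  exact: rpredD.
have -> : b = a by apply/eqP; rewrite eqn_leq leba.
rewrite /R word_count_id eqxx mulr1n.
by rewrite (_ : _ + _ = 0) ?rpred0 //; ring.
Qed.

Lemma rank_seq_set k (P : pred nat) :
  rank_seq [set i : 'I_k.+1 | P i] = [seq i <- iota 0 k.+1 | P i].
Proof.
rewrite /rank_seq -val_enum_ord filter_map; congr (map _ _).
by rewrite [in LHS]/enum_mem -enumT; apply: eq_filter => i; rewrite !inE.
Qed.

Lemma rank_polyE k (T : {set 'I_k.+1}) :
  rank_poly T = (-1) ^+ size (rank_seq T) * euler 0 (rank_seq T).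
Proof. by rewrite /rank_poly size_map -cardE. Qed.

Lemma rank_poly_at0 k (T : {set 'I_k.+1}) : T != set0 -> (rank_poly T).[0] = 0.
Proof.
move=> T0; rewrite hornerM euler_at0; last first.
  have := rank_seq_sorted T; rewrite ltn_sorted_uniq_leq => /andP[_].
  by case: rank_seq.
suff -> : (rank_seq T == [::]) = false by rewrite mulr0.
by rewrite -size_eq0 size_map -cardE cards_eq0; exact/negbTE.
Qed.

Lemma rank_poly_atN1 k (T : {set 'I_k.+1}) : ord0 \notin T ->
  (rank_poly T).[-1] = (-1) ^+ #|T|.
Proof.
move=> T_pos; rewrite hornerM euler_atN1.
  by rewrite mulr1 -polyC1 -polyCN -polyC_exp hornerC.
apply/mapP=> -[t + t0]; rewrite mem_enum => Tt.
by case/negP: T_pos; rewrite (_ : ord0 = t) //; apply: val_inj.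
Qed.

Lemma rank_poly_interval k r : (0 < r <= k)%N ->
  rank_poly [set i : 'I_k.+1 | (r <= i)%N] \is a nonneg.
Proof.
case/andP=> _ lerk; rewrite rank_polyE (rank_seq_set k (leq r)).
have -> : [seq i <- iota 0 k.+1 | (r <= i)%N] = iota r (k.+1 - r).
  apply: (irr_sorted_eq ltn_trans ltnn).
  - exact: (sorted_filter ltn_trans _ (iota_ltn_sorted _ _)).
  - exact: iota_ltn_sorted.
  by move=> i; rewrite mem_filter !mem_iota; lia.
by rewrite size_iota; exact: euler_interval_nonneg.
Qed.

Lemma rank_poly_punctured k r : (0 < r <= k)%N ->
  rank_poly [set i : 'I_k.+1 | (1 <= i)%N && (i != r :> nat)] \is a nonneg.
Proof.
move=> rk; have /andP[r_gt0 lerk] := rk.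
rewrite rank_polyE (rank_seq_set k (fun i => (1 <= i)%N && (i != r))).
have -> : [seq i <- iota 0 k.+1 | (1 <= i)%N && (i != r)] =
    iota 1 r.-1 ++ iota r.+1 (k - r).
  rewrite {1}(_ : k.+1 = 1 + (r.-1 + (1 + (k - r))))%N; last by lia.
  rewrite !iotaD !filter_cat /= add0n add1n prednK // eqxx addn1 [X in _ ++ X]/=.
  by congr (_ ++ _); apply/all_filterP/allP=> i; rewrite mem_iota => ?; lia.
rewrite size_cat !size_iota (_ : r.-1 + (k - r) = k.-1)%N; last by lia.
rewrite euler_punctured // rpredD // rpredMn ?rpredX ?polyOverX //.
Qed.

Lemma rank_poly_pair k a b : (0 < a)%N -> (a < b)%N -> (b <= k)%N ->
  rank_poly [set i : 'I_k.+1 | (i == a :> nat) || (i == b :> nat)] \is a nonneg.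
Proof.
move=> a_gt0 ltab lebk; rewrite rank_polyE.
rewrite (rank_seq_set k (fun i => (i == a) || (i == b))).
have -> : [seq i <- iota 0 k.+1 | (i == a) || (i == b)] = [:: a; b].
  apply: (irr_sorted_eq ltn_trans ltnn).
  - exact: (sorted_filter ltn_trans _ (iota_ltn_sorted _ _)).
  - by rewrite /= ltab.
  by move=> i; rewrite mem_filter mem_iota !inE; lia.
by rewrite sqrrN expr1n mul1r euler_pair_nonneg.
Qed.
(** * The reflection character and falling factorials *)

Section ReflectionCharacter.

Variables (A : finType) (a0 : A).

Local Notation fixed s := [set a : A | s a == a].
Local Notation ones := (const_mx 1 : 'cV[algC]_#|A|).

(** The roots span the vectors v of coordinate sum zero: such a v is the sum of the v_j (e_j -
    e_a0). *)
Lemma root_space_kermx : (root_space A :=: kermx ones)%MS.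
Proof.
apply/eqmxP/andP; split.
  apply/sumsmx_subP=> x _; apply/sumsmx_subP=> y _; rewrite genmxE.
  apply/sub_kermxP; rewrite mulmxBl -!rowE !row_const subrr //.
apply/row_subP=> i; set v := row i _.
have v0 : \sum_j v 0 j = 0.
  have /sub_kermxP : (v <= kermx ones)%MS by exact: row_sub.
  move/matrixP/(_ 0 0); rewrite !mxE => v0; rewrite -[RHS]v0.
  by apply: eq_bigr => j _; rewrite !mxE mulr1.
have -> : v = \sum_j v 0 j *: root_vector (enum_val j) a0.
  rewrite /root_vector; under eq_bigr do rewrite scalerBr enum_valK.
  by rewrite sumrB -scaler_suml v0 scale0r subr0 -row_sum_delta.
apply: summx_sub => j _; apply: scalemx_sub.
by rewrite (sumsmx_sup (enum_val j)) // (sumsmx_sup a0) // genmxE.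
Qed.

(** The sum of coordinates identifies the permutation module modulo the root space with the trivial
    module. *)
Lemma reflection_charE (s : {perm A}) :
  reflection_char A s = #|fixed s|%:R - 1.
Proof.
rewrite cfunE in_setT mulr1n.
have /(canRL (addrK _)) -> := mxtrace_sub_fact_mod (root_space_module A) s.
rewrite [X in X - _]mxtrace_perm_action; congr (_ - _).
pose triv := MxRepresentation (trivial_mx_repr A).
have sim : mx_rsim (factmod_repr (root_space_module A))
                   (submod_repr (mxmodule1 triv)).
  apply: (rsim_factmod_kermx (f := ones)); last 1 first.
  - apply/eqmxP; rewrite submx1 sub1mx andbT.
    rewrite /row_full eqn_leq rank_leq_col lt0n mxrank_eq0.
    apply/eqP=> /matrixP/(_ (enum_rank a0) 0); rewrite !mxE => /eqP.
    by rewrite oner_eq0.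
  - move=> g _; rewrite mulmx1; apply/matrixP=> i j.
    by rewrite mul_perm_action_mx !mxE.
  - exact: root_space_kermx.
rewrite (mxtrace_rsim sim) ?inE // mxtrace_submod1 ?inE //=.
by rewrite mxtrace1.
Qed.

Lemma reflection_power_charE i (s : {perm A}) :
  reflection_power_char A i s = (#|fixed s|%:R - 1) ^+ i.
Proof.
elim: i => [|i IHi]; first by rewrite cfunE in_setT mulr1n mxtrace1.
rewrite /reflection_power_char /= -cfRepr_prod exprS cfunE -IHi.
by rewrite -reflection_charE.
Qed.

End ReflectionCharacter.
(* The coefficient of the falling factorial of order r of f, for r >= 2, in
   (f - 1)^i + (-1)^i (f - 1). *)
Fixpoint falling_coef (i r : nat) : nat :=
  if i is i'.+1 then
    if r == 2 then ~~ odd i : nat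
    else if (r < 2)%N then 0
    else (falling_coef i' r.-1 + r.-1 * falling_coef i' r)%N
  else 0.

Lemma falling_coefS i r : (2 < r)%N ->
  falling_coef i.+1 r = (falling_coef i r.-1 + r.-1 * falling_coef i r)%N.
Proof. by case: r => [|[|[|r]]]. Qed.

Lemma falling_coef2 i : (0 < i)%N -> falling_coef i 2 = ~~ odd i.
Proof. by case: i. Qed.

Lemma falling_coef1 r : falling_coef 1 r = 0.
Proof. by case: r => [|[|[|r]]]; rewrite //= muln0. Qed.

Arguments falling_coef : simpl never.

(** From f - 1 = (f - r) + (r - 1); for f < r all terms vanish. *)
Lemma ffactS_pred (f r : nat) : (0 < r)%N ->
  (f%:R - 1) * (f ^_ r)%:R = (f ^_ r.+1)%:R + (r.-1 * f ^_ r)%:R :> algC.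
Proof.
move=> r_gt0; have [ltfr|lerf] := ltnP f r.
  by rewrite !ffact_small // ?muln0 ?mulr0 ?addr0 // ltnW.
rewrite ffactnSr -natrD mulnC -mulnDl natrM; congr (_ * _).
by rewrite -[1]/(1%:R) -natrB; [congr _%:R; lia | exact: leq_trans lerf].
Qed.

(** Induction on i, multiplying by f - 1 with [ffactS_pred]. The sum may stop at n because f <= n
    kills the higher falling factorials. *)
Lemma falling_coefE (f n i : nat) : (1 < n)%N -> (f <= n)%N -> (0 < i)%N ->
  (f%:R - 1) ^+ i =
  \sum_(2 <= r < n.+1) (f ^_ r * falling_coef i r)%:R - (-1) ^+ i * (f%:R - 1)
    :> algC.
Proof.
move=> n_gt1 lefn; elim: i => // -[_ _|i IHi _].
  by rewrite big1 ?expr1 ?mulN1r ?opprK ?add0r // => r _; rewrite falling_coef1 muln0.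
set x := f%:R - 1 in IHi *; rewrite exprS IHi // mulrBr.
have -> : x * \sum_(2 <= r < n.+1) (f ^_ r * falling_coef i.+1 r)%:R =
    \sum_(3 <= r < n.+1) (f ^_ r * falling_coef i.+2 r)%:R
     + (f ^_ 2 * falling_coef i.+1 2)%:R.
  rewrite big_distrr /=.
  have -> : \sum_(2 <= r < n.+1) x * (f ^_ r * falling_coef i.+1 r)%:R =
      \sum_(2 <= r < n.+1) ((f ^_ r.+1 * falling_coef i.+1 r)%:R
        + (r.-1 * f ^_ r * falling_coef i.+1 r)%:R).
    apply: eq_big_nat => r /andP[le2r _].
    by rewrite natrM mulrA ffactS_pred ?mulrDl -?natrM // ltnW.
  have shift (F : nat -> algC) : \sum_(2 <= r < n.+1) F r.+1 =
      \sum_(3 <= r < n.+1) F r + F n.+1.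
    by have := big_add1 0 +%R 2 n.+2 xpredT F; rewrite big_nat_recr //= => <-.
  rewrite big_split /= (shift (fun r => (f ^_ r * falling_coef i.+1 r.-1)%:R)).
  rewrite ffact_small // mul0n addr0 [X in _ + X]big_ltn //.
  rewrite mul1n addrCA addrC; congr (_ + _); rewrite -big_split.
  apply: eq_big_nat => r /andP[le3r _] /=; rewrite -natrD (falling_coefS i.+1) //.
  congr (_%:R).
  by rewrite mulnDr [(f ^_ r * (_ * _))%N]mulnCA mulnA.
rewrite [in RHS]big_ltn // [in RHS]falling_coef2 // falling_coef2 //.
(* The correction term times x contains x * x = f ^_ 2 - x, whence the alternating coefficient of
   order 2. *)
have f2 : (f ^_ 2)%:R = x * x + x.
  by have := ffactS_pred f (isT : (0 < 1)%N); rewrite mul0n addr0 => <-;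
    rewrite ffactn1 /x; ring.
set S := \sum_(_ <= _ < _) _; rewrite !(natrM _ (f ^_ 2)) f2 !exprS /= negbK.
rewrite -[(-1) ^+ i]signr_odd.
by case: (odd i); rewrite /= ?expr0 ?expr1; ring.
Qed.

(** * The Frobenius characteristic of falling factorials *)

(** All stabilizers along an orbit have order [#|gT|] divided by the length of the orbit. *)
Lemma sum_card_stab (gT : finGroupType) (X : finType) (to : {action gT &-> X}) x :
  (\sum_(z in orbit to [set: gT] x) #|[set g | to z g == z]| = #|gT|)%N.
Proof.
set O := orbit to [set: gT] x.
have O_gt0 : (0 < #|O|)%N by apply/card_gt0P; exists x; exact: orbit_refl.
have stabE z : z \in O -> (#|O| * #|[set g | to z g == z]|)%N = #|gT|.
  move=> Oz; have := card_orbit_stab to [set: gT] z.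
  have -> : orbit to [set: gT] z = O by apply/orbit_eqP.
  rewrite cardsT => <-; congr (_ * _)%N; apply: eq_card => g.
  by rewrite in_setI in_setT [in LHS]inE; apply/eqP/astab1P.
apply/eqP; rewrite -(eqn_pmul2l O_gt0) big_distrr /=.
by rewrite (eq_bigr (fun=> #|gT|) stabE) sum_nat_const.
Qed.

Section ContentMultinomials.

Variable m : nat.
Implicit Types l : seq 'I_m.

Definition content l : 'X_{1..m} := [multinom count_mem i l | i < m].

Lemma content_cons i l : content (i :: l) = (U_(i) + content l)%MM.
Proof. by apply/mnmP=> j; rewrite mnmDE !mnmE. Qed.

Lemma mpolyX_content l : 'X_[content l] = \prod_(i <- l) 'X_i :> {mpoly algC[m]}.
Proof.
elim: l => [|i l IHl]; last by rewrite content_cons mpolyXD IHl big_cons.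
by rewrite big_nil -mpolyX0; congr 'X_[_]; apply/mnmP=> j; rewrite !mnmE.
Qed.

Lemma mdeg_content l : mdeg (content l) = size l.
Proof.
elim: l => [|i l IHl]; last by rewrite content_cons mdegD mdeg1 IHl.
by rewrite mdegE big1 // => j _; rewrite mnmE.
Qed.

Lemma content_perm l l' : (content l == content l') = perm_eq l l'.
Proof.
apply/eqP/idP => [eq_c|/seq.permP eq_l]; last by apply/mnmP=> j; rewrite !mnmE eq_l.
by apply/allP=> j _ /=; have /mnmP/(_ j) := eq_c; rewrite !mnmE => ->.
Qed.

Lemma content_surj (u : 'X_{1..m}) : exists l, content l = u.
Proof.
exists (flatten [seq nseq (u j) j | j <- enum 'I_m]); apply/mnmP=> i.
rewrite mnmE count_flatten sumnE big_map big_map big_enum /= (bigD1 i) //= big1.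
  by rewrite count_nseq /= eqxx mul1n addn0.
by move=> j /negPf nji; rewrite count_nseq /= nji.
Qed.

End ContentMultinomials.

Lemma perm_enum_perm (A : finType) (l l' : seq A) :
    perm_eq l (enum A) -> perm_eq l' (enum A) ->
  exists s : {perm A}, map s l = l'.
Proof.
move=> pl pl'; have ul : uniq l by rewrite (perm_uniq pl) enum_uniq.
have ul' : uniq l' by rewrite (perm_uniq pl') enum_uniq.
have szl : size l = size l' by rewrite (perm_size pl) (perm_size pl').
have ml a : a \in l by rewrite (perm_mem pl) mem_enum.
have f_inj : injective (fun a => nth a l' (index a l)).
  move=> a b; rewrite (set_nth_default a b) -?szl ?index_mem // => /eqP.
  rewrite nth_uniq -?szl ?index_mem // => /eqP eq_ab.
  by rewrite -(nth_index a (ml a)) eq_ab nth_index.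
exists (perm f_inj); have sE := permE f_inj; move: (perm f_inj) sE => s sE.
case def_l: {1}l => [|a0 l0].
  by symmetry; apply/nilP; rewrite /nilp -szl def_l.
rewrite -def_l; apply: (@eq_from_nth _ a0); first by rewrite size_map.
move=> i; rewrite size_map => lti; rewrite (nth_map a0) // sE index_uniq //.
by apply: set_nth_default; rewrite -szl.
Qed.

Section ColouringAction.

Variables (A : finType) (m r : nat).

Local Notation Z := ({ffun A -> 'I_m} * r.-tuple A)%type.
Implicit Types (w : {ffun A -> 'I_m}) (t : r.-tuple A) (z : Z) (s : {perm A}).

(** A colouring of the letters with r marked letters, both transported by s: the inverse makes each
    colour move with its letter. *)
Definition colouring_act z s : Z :=
  ([ffun a => z.1 (s^-1 a)%g], map_tuple s z.2).

Lemma colouring_act1 : colouring_act ^~ 1%g =1 id.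
Proof.
case=> w t; congr (_, _); first by apply/ffunP=> a; rewrite ffunE invg1 perm1.
by apply: val_inj; apply: map_id_in => a _; exact: perm1.
Qed.

Lemma colouring_actM z : act_morph colouring_act z.
Proof.
case: z => w t s s'; congr (_, _).
  by apply/ffunP=> a; rewrite !ffunE invMg permM.
by apply: val_inj; rewrite /= -map_comp; apply: eq_map => a /=; exact: permM.
Qed.

Definition colouring_action := TotalAction colouring_act1 colouring_actM.

Definition remaining t := [seq a <- enum A | a \notin t].

Definition rest_content z : 'X_{1..m} := content (map z.1 (remaining z.2)).

Lemma perm_remaining t : uniq t -> perm_eq (t ++ remaining t) (enum A).
Proof.
move=> ut; apply: uniq_perm; rewrite ?enum_uniq //.
  rewrite cat_uniq ut filter_uniq ?enum_uniq // andbT; apply/hasPn=> a.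
  by rewrite mem_filter => /andP[].
by move=> a; rewrite mem_cat mem_filter mem_enum; case: (a \in t).
Qed.

Lemma size_remaining t : uniq t -> size (remaining t) = (#|A| - r)%N.
Proof.
move/perm_remaining/perm_size; rewrite size_cat size_tuple -cardE => <-.
by rewrite addKn.
Qed.

(** The colours of the marked letters, in order, and the multiset of the other colours are complete
    invariants of the orbit. *)
Lemma colouring_orbit z z' : uniq z.2 -> uniq z'.2 ->
  (z' \in orbit colouring_action [set: {perm A}] z) =
    (map z.1 z.2 == map z'.1 z'.2) && (rest_content z == rest_content z').
Proof.
case: z z' => w t [w' t'] /= ut ut'; apply/imsetP/andP => [[s _ [-> ->]]|[eq_t eq_u]].
  rewrite -map_comp; split.
    by apply/eqP/eq_map => a /=; rewrite ffunE permK.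
  rewrite /rest_content content_perm /=.
  have -> : map w (remaining t) =
      map [ffun a => w (s^-1 a)%g] (map s (remaining t)).
    by rewrite -map_comp; apply: eq_map => a /=; rewrite ffunE permK.
  apply: perm_map; apply: uniq_perm.
  - by rewrite (map_inj_uniq perm_inj) filter_uniq ?enum_uniq.
  - by rewrite filter_uniq ?enum_uniq.
  move=> a; rewrite mem_filter mem_enum andbT -[a](permKV s).
  by rewrite !(mem_map perm_inj) mem_filter mem_enum andbT.
(* List the marked letters first and the others sorted by colour. Both lists then have the same
   sequence of colours, and the permutation matching them carries one colouring to the other. *)
pose le w := relpre w (fun i j : 'I_m => i <= j)%N.
pose l w t := t ++ sort (le w) (remaining t).
have pl v (q : r.-tuple A) : uniq q -> perm_eq (l v q) (enum A).
  move=> uq; rewrite -(permPr (perm_remaining uq)) perm_cat2l.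
  by rewrite perm_sort.
have [s def_l'] := perm_enum_perm (pl w t ut) (pl w' t' ut').
have eq_l : map w' (map s (l w t)) = map w (l w t).
  rewrite def_l' !map_cat (eqP eq_t) /le -!sort_map; congr (_ ++ _).
  apply/perm_sortP; [by move=> i j; exact: leq_total
    | by move=> i j k; exact: leq_trans
    | by move=> i j /anti_leq/val_inj |].
  by rewrite perm_sym -content_perm.
have ws a : w' (s a) = w a.
  move: eq_l; rewrite -map_comp => /eq_in_map/(_ a); apply.
  by rewrite (perm_mem (pl w t ut)) mem_enum.
exists s; rewrite ?inE //; congr (_, _).
  by apply/ffunP=> a; rewrite ffunE -ws permKV.
apply: val_inj => /=; move: def_l'; rewrite /l map_cat => /eqP.
by rewrite eqseq_cat ?size_map ?size_tuple // => /andP[/eqP].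
Qed.

End ColouringAction.
Section FallingFactorialFrobenius.

Variables (A : finType) (m r : nat).
Hypotheses (r_gt0 : (0 < r)%N) (le_rA : (r <= #|A|)%N).

Local Notation Z := ({ffun A -> 'I_m} * r.-tuple A)%type.
Local Notation d := (#|A| - r)%N.
Implicit Types (w : {ffun A -> 'I_m}) (s : {perm A}).

Definition colouring_weight w : {mpoly algC[m]} := \prod_a 'X_(w a).

Lemma colouring_weightE (z : Z) : uniq z.2 ->
  colouring_weight z.1 = 'X_[content (map z.1 z.2)] * 'X_[rest_content z].
Proof.
move=> uz; rewrite !mpolyX_content !big_map -big_cat.
by rewrite (perm_big _ (perm_remaining uz)) /= big_enum.
Qed.

Lemma complete_sym1 : complete_sym m 1 = \sum_i 'X_i.
Proof.
have U1 i : (mdeg (U_(i)%MM : 'X_{1..m}) < 2)%N by rewrite mdeg1.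
transitivity (\sum_(u : 'X_{1..m < 2} | mdeg u == 1)
    \sum_(i | val u == U_(i)%MM) 'X_i : {mpoly algC[m]}).
  apply: eq_bigr => u; rewrite mdeg_eq1 => /existsP[i /eqP u_i].
  rewrite [X in 'X_[X]]u_i (big_pred1 i) // => j /=; rewrite u_i.
  apply/eqP/eqP => [/mnmP/(_ i)|->//]; rewrite !mnm1E eqxx.
  by case: eqP.
rewrite (exchange_big_dep xpredT) //=; apply: eq_bigr => i _.
rewrite (big_pred1 (BMultinom (U1 i))) // => u /=.
apply/andP/eqP => [[_ /eqP def_u]|->]; first exact: val_inj.
by rewrite /= mdeg1 !eqxx.
Qed.

Lemma sum_tuple_content :
  \sum_(i : r.-tuple 'I_m) 'X_[content i] = complete_sym m 1 ^+ r.
Proof.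
rewrite complete_sym1; elim: r => [|k IHk].
  rewrite expr0 (big_pred1 [tuple]) => [|t]; first by rewrite mpolyX_content big_nil.
  by rewrite [t]tuple0; exact/esym/eqP.
rewrite big_tuple_cons exprS -IHk big_distrlr; apply: eq_bigr => i _ /=.
by apply: eq_bigr => t _; rewrite content_cons mpolyXD.
Qed.

Lemma colouring_exists (i : r.-tuple 'I_m) (u : 'X_{1..m}) : mdeg u = d ->
  exists z : Z, [/\ uniq z.2, map z.1 z.2 = i & rest_content z = u].
Proof.
have [l <-] := content_surj u; rewrite mdeg_content => sz_l.
have sz_L : size (i ++ l) = size (enum A).
  by rewrite size_cat size_tuple sz_l -cardE subnKC.
(* A default colour exists because r > 0 makes the list nonempty. *)
have [i0 _] : exists i0, i0 \in i ++ l.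
  case def_L: (i ++ l) sz_L => [|i0 L] sz_L; last by exists i0; exact: mem_head.
  by move: le_rA r_gt0; rewrite cardE -sz_L /=; lia.
pose w := [ffun a => nth i0 (i ++ l) (index a (enum A))].
have wE : map w (enum A) = i ++ l.
  apply: (@eq_from_nth _ i0); first by rewrite size_map sz_L.
  move=> j; rewrite size_map => ltj; have [a0 _] : exists a0 : A, true.
    by case: (enum A) ltj => // a0; exists a0.
  by rewrite (nth_map a0) // ffunE index_uniq ?enum_uniq.
have sz_t : size (take r (enum A)) == r by rewrite size_takel -?cardE.
have ut : uniq (Tuple sz_t) by rewrite take_uniq ?enum_uniq.
exists (w, Tuple sz_t); split=> //=.
  by rewrite map_take wE take_size_cat ?size_tuple.
apply/eqP; rewrite content_perm /=.
have -> : l = map w (drop r (enum A)) by rewrite map_drop wE drop_size_cat ?size_tuple.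
apply: perm_map; rewrite -(perm_cat2l (take r (enum A))) cat_take_drop.
exact: perm_remaining ut.
Qed.

(** Orbits correspond to an r-tuple of colours and a monomial of degree d. Each contributes its
    monomial [#|{perm A}|] times, and the monomials sum to h_1^r h_d. *)
Lemma sum_colourings :
  \sum_(z : Z | uniq z.2)
      colouring_weight z.1 *+ #|[set s | colouring_action A m r z s == z]|
    = hook_complete_sym m #|A| r *+ #|{perm A}|.
Proof.
(* The default [bm0] is not reached for distinct marked letters: the other letters then number d. *)
pose q (z : Z) : r.-tuple 'I_m * 'X_{1..m < d.+1} :=
  (map_tuple z.1 z.2, insubd bm0 (rest_content z)).
have mdeg_rest (z : Z) : uniq z.2 -> mdeg (rest_content z) = d.
  by move=> uz; rewrite mdeg_content size_map size_remaining.
have q2 (z : Z) : uniq z.2 -> val (q z).2 = rest_content z.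
  by move=> uz; rewrite val_insubd mdeg_rest ?ltnSn.
rewrite (partition_big q (fun y => mdeg (val y.2) == d)) => [|z uz] /=; last first.
  by rewrite q2 // mdeg_rest.
transitivity (\sum_(y : r.-tuple 'I_m * 'X_{1..m < d.+1} | mdeg (val y.2) == d)
    'X_[content y.1] * 'X_[val y.2] *+ #|{perm A}| : {mpoly algC[m]}).
  apply: eq_bigr => -[i u] /eqP /= degu.
  have [z0 [uz0 z0i z0u]] := colouring_exists i degu.
  rewrite -(sum_card_stab (colouring_action A m r) z0) -sumrMnr.
  apply: eq_big => [z|z /andP[uz /eqP def_y]]; last first.
    rewrite colouring_weightE //; congr (_ * _ *+ _).
    - by have -> : i = (q z).1 by rewrite def_y.
    - by rewrite -q2 // def_y.
  have [uz|nuz] := boolP (uniq z.2); last first.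
    apply/esym/negP=> /imsetP[s _ def_z]; case/negP: nuz.
    by rewrite def_z /= (map_inj_uniq perm_inj).
  rewrite colouring_orbit // z0i z0u /= xpair_eqE -!val_eqE /=.
  rewrite val_insubd mdeg_rest // ltnSn.
  by congr (_ && _); exact: eq_sym.
rewrite sumrMnl /=; congr (_ *+ _).
rewrite /hook_complete_sym -sum_tuple_content big_distrlr pair_big /=.
by apply: eq_bigl => y.
Qed.

(** Expanding the product chooses a colour for each cycle, that is, a colouring constant on the
    cycles of s. *)
Lemma porbits_power_sum s : (0 < m)%N ->
  \prod_(c in porbits s) power_sum m #|c| =
  \sum_(w : {ffun A -> 'I_m} | [ffun a => w (s^-1 a)%g] == w) colouring_weight w.
Proof.
move=> m_gt0; pose j0 := Ordinal m_gt0; rewrite /power_sum (big_distr_big j0) /=.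
pose h w : {ffun {set A} -> 'I_m} :=
  [ffun c => if c \in porbits s then
               if [pick a in c] is Some a then w a else j0 else j0].
pose g (f : {ffun {set A} -> 'I_m}) := [ffun a => f (porbit s a)].
have w_const w : [ffun a => w (s^-1 a)%g] == w ->
    forall a b, b \in porbit s a -> w b = w a.
  move=> /eqP/ffunP fix_w a b /porbitP[i ->]; elim: i => [|i IHi].
    by rewrite expg0 perm1.
  by rewrite expgSr permM -IHi -(fix_w (s _)) ffunE permK.
have pick_orbit a : exists2 b, b \in porbit s a & [pick b in porbit s a] = Some b.
  by case: pickP => [b|/(_ a)]; [exists b | rewrite porbit_id].
have hE w a : [ffun a => w (s^-1 a)%g] == w -> h w (porbit s a) = w a.
  move=> fix_w; rewrite ffunE imset_f //.
  by have [b ab ->] := pick_orbit a; exact: w_const.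
rewrite (reindex_onto h g) => [|f /pffun_onP[/subsetP supp_f _]]; last first.
  apply/ffunP=> c; rewrite ffunE; case: ifP => [/imsetP[a _ ->]|nc].
    have [b ab ->] := pick_orbit a; rewrite ffunE; congr (f _).
    by apply/eqP; rewrite eq_porbit_mem.
  by apply/esym/eqP; apply: contraFT nc => fc; apply: supp_f.
have condE w : (h w \in pffun_on j0 (mem (porbits s)) predT) && (g (h w) == w) =
    ([ffun a => w (s^-1 a)%g] == w).
  apply/andP/idP => [[_ /eqP gh]|fix_w]; last first.
    split; last by apply/eqP/ffunP=> a; rewrite ffunE hE.
    apply/pffun_onP; split=> //; apply/subsetP=> c; rewrite inE ffunE.
    by apply: contraNT => /negPf ->.
  apply/eqP/ffunP=> a; rewrite ffunE -gh !ffunE.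
  suff -> : porbit s (s^-1 a)%g = porbit s a by [].
  by apply/eqP; rewrite eq_porbit_mem -porbitV -{1}[(s^-1)%g]expg1 mem_porbit.
apply: eq_big => [w|w]; first exact: condE.
rewrite condE => fix_w.
rewrite /colouring_weight (partition_big (porbit s) (mem (porbits s))) /=.
  apply: eq_bigr => c /imsetP[a _ ->].
  rewrite (eq_bigr (fun=> 'X_(w a))) => [|b /eqP/esym/eqP]; last first.
    by rewrite eq_porbit_mem porbit_sym => /(w_const w fix_w) ->.
  rewrite hE // prodr_const; congr (_ ^+ _); apply: eq_card => b.
  by rewrite -[LHS]eq_porbit_mem.
by move=> a _; apply: imset_f.
Qed.

(** The falling factorial counts the r-tuples of distinct letters fixed by s, so the left side sums
    the weights of the marked colourings fixed by s; exchanging the sums gives [sum_colourings]. *)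
Lemma falling_frobenius :
  \sum_(s : {perm A}) (#|[set a | s a == a]| ^_ r)%:R *:
      \prod_(c in porbits s) power_sum m #|c|
    = hook_complete_sym m #|A| r *+ #|{perm A}|.
Proof.
(* Without variables there is no colour to choose, but both sides vanish: A is nonempty and h_1 =
   0. *)
case: (posnP m) => [m0|m_gt0].
  have p0 k : power_sum m k = 0 by rewrite /power_sum big1 // => -[i lti]; lia.
  rewrite /hook_complete_sym complete_sym1 [\sum_i 'X_i]big1 => [|[i lti]]; last by lia.
  rewrite expr0n gtn_eqF // mul0r mul0rn big1 // => s _.
  have [a _] : exists a : A, a \in A by apply/card_gt0P; apply: leq_trans le_rA.
  by rewrite (bigD1 (porbit s a)) ?imset_f //= p0 mul0r scaler0.
rewrite -sum_colourings.
transitivity (\sum_(s : {perm A})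
    \sum_(z : Z | uniq z.2 && (colouring_action A m r z s == z))
    colouring_weight z.1); last first.
  rewrite (exchange_big_dep (fun z : Z => uniq z.2)) /= => [|s z _ /andP[]//].
  apply: eq_bigr => z uz; rewrite -sumr_const; apply: eq_bigl => s.
  by rewrite uz inE.
apply: eq_bigr => s _; rewrite porbits_power_sum // scaler_sumr.
rewrite (eq_bigr (fun w => \sum_(t : r.-tuple A | uniq t && (map_tuple s t == t))
    colouring_weight w)) => [|w _].
  rewrite pair_big /=; apply: eq_bigl => -[w t] /=.
  by rewrite xpair_eqE andbCA.
rewrite scaler_nat sumr_const; congr (_ *+ _).
rewrite -card_uniq_tuples; apply: eq_card => t; rewrite !inE andbC; congr (_ && _).
rewrite -val_eqE /=; elim: (val t) => //= a u ->.
by rewrite eqseq_cons -[_ a]/(a \in [set a0 | s a0 == a0]) inE.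
Qed.

End FallingFactorialFrobenius.

(** * The two expansions and their coefficients *)

Section Assembly.

Variables (A : finType) (k : nat) (T : {set 'I_k.+1}).
Hypotheses (A_gt1 : (1 < #|A|)%N) (T_pos : ord0 \notin T) (T_neq0 : T != set0).

Local Notation P := (rank_poly T).
Local Notation fix_card s := #|[set a : A | s a == a]|.

Lemma horner_rank_poly (x : int) :
  P.[x]%:~R = \sum_(1 <= i < (size P).+1) (P`_i)%:~R * x%:~R ^+ i :> algC.
Proof.
(* The vanishing at 0 is what excludes the trivial module, the tensor power of exponent 0. *)
have P0 : P`_0 = 0 by rewrite -horner_coef0 rank_poly_at0.
rewrite (horner_coef_wide _ (leqnSn (size P))) rmorph_sum big_ord_recl.
rewrite P0 mul0r rmorph0 add0r big_add1 big_mkord; apply: eq_bigr => i _.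
by rewrite rmorphM rmorphXn.
Qed.

Lemma homology_char_sum (s : {perm A}) : homology_char A T s =
  \sum_(1 <= i < (size P).+1) (P`_i)%:~R * ((fix_card s)%:R - 1) ^+ i.
Proof.
have [a0 _] : exists a0 : A, a0 \in A by apply/card_gt0P; exact: ltnW.
rewrite (homology_charE a0 T_pos T_neq0) horner_rank_poly.
by apply: eq_bigr => i _; rewrite rmorphB rmorph_nat rmorph1.
Qed.

Lemma homology_char_powers : homology_char A T =
  \sum_(1 <= i < (size P).+1) reflection_power_char A i *~ P`_i.
Proof.
have [a0 _] : exists a0 : A, a0 \in A by apply/card_gt0P; exact: ltnW.
apply/cfunP=> s; rewrite homology_char_sum sum_cfunE; apply: eq_bigr => i _.
by rewrite -scaler_int cfunE (reflection_power_charE a0).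
Qed.

(** The coefficient of the falling factorial of order r once each power x^i of P_T is completed to
    x^i + (-1)^i x. *)
Definition hook_coef r : int :=
  \sum_(1 <= i < (size P).+1) P`_i * (falling_coef i r)%:R.

Lemma twisted_homology_char (s : {perm A}) :
  (homology_char A T + (-1) ^+ #|T| *: reflection_char A) s =
  \sum_(2 <= r < #|A|.+1) (fix_card s ^_ r)%:R * (hook_coef r)%:~R.
Proof.
have [a0 _] : exists a0 : A, a0 \in A by apply/card_gt0P; exact: ltnW.
rewrite cfunE homology_char_sum cfunE (reflection_charE a0).
(* Since the sign is P.[-1], the added multiple of x distributes over the powers, giving x^i +
   (-1)^i x for each. *)
have -> : (-1) ^+ #|T| = \sum_(1 <= i < (size P).+1) (P`_i)%:~R * (-1) ^+ i :> algC.
  have := horner_rank_poly (-1); rewrite rank_poly_atN1 // rmorphXn rmorphN1 => ->.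
  by [].
rewrite big_distrl -big_split /=.
transitivity (\sum_(1 <= i < (size P).+1) \sum_(2 <= r < #|A|.+1)
    (fix_card s ^_ r)%:R * ((P`_i)%:~R * (falling_coef i r)%:R) : algC).
  apply: eq_big_nat => i /andP[i_gt0 _].
  rewrite (falling_coefE A_gt1 (max_card _) i_gt0) mulrBr -mulrA subrK.
  by rewrite big_distrr; apply: eq_bigr => r _; rewrite natrM mulrCA.
rewrite exchange_big; apply: eq_bigr => r _; rewrite rmorph_sum big_distrr.
by apply: eq_bigr => i _; rewrite rmorphM rmorph_nat.
Qed.

Lemma twisted_homology_frobenius m :
  frobenius_char m (homology_char A T + (-1) ^+ #|T| *: reflection_char A) =
  \sum_(2 <= r < #|A|.+1) hook_complete_sym m #|A| r *~ hook_coef r.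
Proof.
rewrite /frobenius_char; under eq_bigr do rewrite twisted_homology_char scaler_suml.
rewrite exchange_big scaler_sumr; apply: eq_big_nat => r /andP[r_gt1 lerA] /=.
under eq_bigr do rewrite mulrC -scalerA.
rewrite -scaler_sumr falling_frobenius ?(ltnW r_gt1) // -scaler_nat !scalerA.
rewrite mulrAC mulVf ?mul1r ?scaler_int //.
by rewrite pnatr_eq0 -lt0n; apply/card_gt0P; exists 1%g.
Qed.

Lemma hook_coef_ge0 r : P \is a nonneg -> 0 <= hook_coef r.
Proof.
move=> /polyOverP P_ge0; apply: sumr_ge0 => i _; apply: mulr_ge0 => //.
exact: P_ge0.
Qed.

End Assembly.

Theorem theorem2 (A : finType) (n k : nat) (T : {set 'I_k.+1}) :
  #|A| = n -> (2 <= n)%N -> (1 <= k)%N ->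
  T != set0 -> ord0 \notin T ->
  [/\ (exists (N : nat) (a : nat -> int),
         homology_char A T =
         \sum_(1 <= i < N.+1) reflection_power_char A i *~ a i),
      (exists b : nat -> int, forall m : nat,
         frobenius_char m
           (homology_char A T + (-1) ^+ #|T| *: reflection_char A) =
         \sum_(2 <= r < n.+1) hook_complete_sym m n r *~ b r)
    & [\/ (exists2 r : nat, (1 <= r <= k)%N &
             T = [set i : 'I_k.+1 | (r <= i)%N]),
          (exists2 r : nat, (1 <= r <= k)%N &
             T = [set i : 'I_k.+1 | (1 <= i)%N && (i != r :> nat)])
        | (exists s1 s2 : nat, [/\ (1 <= s1)%N, (s1 < s2)%N, (s2 <= k)%N &
             T = [set i : 'I_k.+1 | (i == s1 :> nat) || (i == s2 :> nat)]])] ->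
      (exists (N : nat) (a : nat -> int),
         (forall i, 0 <= a i) /\
         homology_char A T =
         \sum_(1 <= i < N.+1) reflection_power_char A i *~ a i) /\
      (exists b : nat -> int,
         (forall r, 0 <= b r) /\
         forall m : nat,
           frobenius_char m
             (homology_char A T + (-1) ^+ #|T| *: reflection_char A) =
           \sum_(2 <= r < n.+1) hook_complete_sym m n r *~ b r)].
Proof.
move=> <- A_gt1 _ T_neq0 T_pos.
have decomp := homology_char_powers A_gt1 T_pos T_neq0.
have frob := twisted_homology_frobenius A_gt1 T_pos T_neq0.
split.
- by exists (size (rank_poly T)), (fun i => (rank_poly T)`_i).
- by exists (hook_coef T).
(* The coefficients of the general case serve again: both families are nonnegative once
   [rank_poly T] is. *)
move=> T_cases; have nnP : rank_poly T \is a nonneg.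
  case: T_cases => [[r rk ->]|[r rk ->]|[s1 [s2 [s1_gt0 lts12 les2k ->]]]].
  - exact: rank_poly_interval.
  - exact: rank_poly_punctured.
  - exact: rank_poly_pair.
split.
  exists (size (rank_poly T)), (fun i => (rank_poly T)`_i); split=> // i.
  by move/polyOverP: nnP; apply.
by exists (hook_coef T); split=> // r; exact: hook_coef_ge0.
Qed.
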